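(* Let $0=s_0<s_1<\cdots<s_k<s_{k+1}=T$, $\mathbf{s}=(s_1,\dots,s_k)$, be fixed, and let $(\bar{\mathbf{x}},\bar{\mathbf{p}})$ be an absolutely continuous solution on $[0,T]$ of the coupled system $$\dot{\mathbf{x}}(t)=\mathbf{F}(\mathbf{x}(t),\mathbf{p}(t),t),\qquad \dot{\mathbf{p}}(t)=-\mathbf{p}(t)\mathbf{F}_x(\mathbf{x}(t),\mathbf{p}(t),t),\qquad (\mathbf{x}(0),\mathbf{p}(0))=(\mathbf{x}_0,\mathbf{p}_0),$$ corresponding to $\mathbf{p}_0=\bar{\mathbf{p}}_0$. Suppose that the Generalized State Regularity property (defined in the context) holds at $(\bar{\mathbf{x}},\bar{\mathbf{p}})$. Let $\mathbf{y}=(\mathbf{y}_1,\mathbf{y}_2):[0,T]\to\mathbb{R}^{2n}$ (a row vector) be the solution of the linear system $$\dot{\mathbf{y}}_1(t)=-\nabla_x\mathcal{H}_j(\bar{\mathbf{x}}(t),\bar{\mathbf{p}}(t),\mathbf{y}(t),t),\quad \mathbf{y}_1(T)=\nabla C(\bar{\mathbf{x}}(T)),$$ $$\dot{\mathbf{y}}_2(t)=-\nabla_p\mathcal{H}_j(\bar{\mathbf{x}}(t),\bar{\mathbf{p}}(t),\mathbf{y}(t),t),\quad \mathbf{y}_2(T)=\mathbf{0},$$ on $(s_j,s_{j+1})$ for $j=k,k-1,\dots,0$. Then $$\left.\frac{\partial C(\mathbf{s},\mathbf{p}_0)}{\partial\mathbf{p}_0}\right|_{\mathbf{p}_0=\bar{\mathbf{p}}_0}=\nabla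 C(\bar{\mathbf{x}}(T))\left.\frac{\partial\mathbf{x}(T)}{\partial\mathbf{p}_0}\right|_{\mathbf{p}_0=\bar{\mathbf{p}}_0}=\mathbf{y}_2(0).$$
   Context: Setting. $T>0$ and $\mathbf{x}_0\in\mathbb{R}^n$ are fixed; $\mathbf{f}:\mathbb{R}^n\times\mathbb{R}^m\to\mathbb{R}^n$ and $C:\mathbb{R}^n\to\mathbb{R}$ are differentiable. The control has the form $\mathbf{u}(t)=\boldsymbol{\phi}_j(\mathbf{x}(t),\mathbf{p}(t),t)$ on $(s_j,s_{j+1})$, $0\le j\le k$, where $\mathbf{p}$ (a row vector in $\mathbb{R}^n$) is the costate. Define $$\mathbf{f}_j(\mathbf{x},\mathbf{p},t)=\mathbf{f}(\mathbf{x},\boldsymbol{\phi}_j(\mathbf{x},\mathbf{p},t)),\qquad \mathbf{f}_{jx}(\mathbf{x},\mathbf{p},t)=\nabla_x\mathbf{f}(\mathbf{x},\mathbf{u})\big|_{\mathbf{u}=\boldsymbol{\phi}_j(\mathbf{x},\mathbf{p},t)},$$ where $\nabla_x\mathbf{f}(\mathbf{x},\mathbf{u})$ is the Jacobian of $\mathbf{f}$ in its first argument with $\mathbf{u}$ held fixed, and set $\mathbf{F}(\mathbf{x},\mathbf{p},t)=\mathbf{f}_j(\mathbf{x},\mathbf{p},t)$, $\mathbf{F}_x(\mathbf{x},\mathbf{p},t)=\mathbf{f}_{jx}(\mathbf{x},\mathbf{p},t)$ for $t\in(s_j,s_{j+1})$. Generalized Hamiltonian: for a row vector $\mathbf{y}=(\mathbf{y}_1,\mathbf{y}_2)\in\mathbb{R}^{2n}$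 with $\mathbf{y}_1,\mathbf{y}_2\in\mathbb{R}^n$, $$\mathcal{H}_j(\mathbf{x},\mathbf{p},\mathbf{y},t)=\mathbf{y}_1\mathbf{f}_j(\mathbf{x},\mathbf{p},t)-\mathbf{p}\,\mathbf{f}_{jx}(\mathbf{x},\mathbf{p},t)\,\mathbf{y}_2^{\mathsf T},\qquad 0\le j\le k.$$ $\nabla_x\mathcal{H}_j$ and $\nabla_p\mathcal{H}_j$ are its gradients (row vectors) with respect to $\mathbf{x}$ and $\mathbf{p}$; $\nabla C$ and the gradient with respect to $\mathbf{p}_0$ are row vectors. Differential equations hold at almost every $t$, with absolutely continuous solutions. $C(\mathbf{s},\mathbf{p}_0)$ denotes $C(\mathbf{x}(T))$, where $(\mathbf{x},\mathbf{p})$ solves the coupled system with switching points $\mathbf{s}$ and initial condition $(\mathbf{x}_0,\mathbf{p}_0)$; $\mathbf{x}(T)$ is regarded as a function of $\mathbf{p}_0$. Generalized State Regularity (at $(\bar{\mathbf{x}},\bar{\mathbf{p}})$). There exist constants $\rho>0$, $s_j^-\in(s_{j-1},s_j)$ and $s_j^+\in(s_j,s_{j+1})$, $1\le j\le k$, such that, with $s_0^-=0$ and $s_{k+1}^+=T$, for each $0\le j\le k$ the pair $(\mathbf{f}_j,\mathbf{f}_{jx})$ is continuously differentiable on the tube $\mathcal{T}_j$ consisting of all $(\boldsymbol{\chi},t)$ with $t\in[s_j^-,s_{j+1}^+]$ and $\boldsymbol{\chi}\in\mathbb{R}^{2n}$ in the closed ball of radius $\rho$ centered at $(\bar{\mathbf{x}}(t),\bar{\mathbf{p}}(t))$.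 Moreover $(\mathbf{f}_j(\boldsymbol{\chi},t),\mathbf{f}_{jx}(\boldsymbol{\chi},t))$ is Lipschitz continuously differentiable with respect to $\boldsymbol{\chi}$ on $\mathcal{T}_j$ (its derivative in $\boldsymbol{\chi}$ is Lipschitz in $\boldsymbol{\chi}$), uniformly in $j$ and $t\in[s_j^-,s_{j+1}^+]$. *)

(* Defs.v *)
From HB Require Import structures.
From mathcomp Require Import all_boot all_order all_algebra.
From mathcomp Require Import all_classical all_reals all_analysis.

Set Implicit Arguments.
Unset Strict Implicit.
Unset Printing Implicit Defensive.

Import Order.TTheory GRing.Theory Num.Theory.
Import numFieldNormedType.Exports.

Local Open Scope classical_set_scope.
Local Open Scope ring_scope.

(* All vectors are row vectors, so the products with column vectors x, f found
   on paper become products with transposes.  The library's ['J g x] acts on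
   row vectors from the right; its transpose is the usual matrix of partial
   derivatives (d g_i / d x_j). *)
Definition jac (R : realType) (n m : nat) (g : 'rV[R]_n -> 'rV[R]_m)
    (x : 'rV[R]_n) : 'M[R]_(m, n) := ('J g x)^T.

Definition gradient (R : realType) (n : nat) (g : 'rV[R]_n -> R)
    (x : 'rV[R]_n) : 'rV[R]_n := \row_i 'D_(delta_mx 0 i) g x.

Definition abs_continuous (R : realType) (V : normedModType R) (a b : R)
    (g : R -> V) : Prop :=
  forall e : R, 0 < e -> exists2 d : R, 0 < d &
    forall (N : nat) (u v : 'I_N -> R),
      (forall i, [/\ a <= u i, u i <= v i & v i <= b]) ->
      trivIset [set: 'I_N] (fun i => [set` `]u i, v i[ ]) ->
      \sum_i (v i - u i) < d ->
      \sum_i `|g (v i) - g (u i)| < e.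

Definition ae_between (R : realType) (a b : R) (P : R -> Prop) : Prop :=
  {ae @lebesgue_measure R, forall t : R, t \in `]a, b[ -> P t}.

(* f_j and f_jx; in the latter the control is frozen at its value before
   differentiating in the state. *)
Definition fj (R : realType) (n m : nat)
    (f : 'rV[R]_n * 'rV[R]_m -> 'rV[R]_n)
    (phi : nat -> 'rV[R]_n -> 'rV[R]_n -> R -> 'rV[R]_m)
    (j : nat) (x p : 'rV[R]_n) (t : R) : 'rV[R]_n :=
  f (x, phi j x p t).

Definition fjx (R : realType) (n m : nat)
    (f : 'rV[R]_n * 'rV[R]_m -> 'rV[R]_n)
    (phi : nat -> 'rV[R]_n -> 'rV[R]_n -> R -> 'rV[R]_m)
    (j : nat) (x p : 'rV[R]_n) (t : R) : 'M[R]_n :=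
  let u := phi j x p t in jac (fun x' => f (x', u)) x.

Definition hamiltonian (R : realType) (n m : nat)
    (f : 'rV[R]_n * 'rV[R]_m -> 'rV[R]_n)
    (phi : nat -> 'rV[R]_n -> 'rV[R]_n -> R -> 'rV[R]_m)
    (j : nat) (x p y1 y2 : 'rV[R]_n) (t : R) : R :=
  (y1 *m (fj f phi j x p t)^T) 0 0 - (p *m fjx f phi j x p t *m y2^T) 0 0.

(* Switching points s 0 = 0 < s 1 < ... < s k < s k.+1 = T; the values of s
   beyond k.+1 are irrelevant, and so are those of phi beyond k. *)
Definition switching_points (R : realType) (T : R) (k : nat) (s : nat -> R) :
    Prop :=
  [/\ s 0%N = 0, s k.+1 = T & forall j, (j <= k)%N -> s j < s j.+1].

(* The coupled system on [0, T], with its piecewise right-hand side spelled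
   out on each (s j, s j.+1).  x and p are total functions of which only the
   restrictions to [0, T] matter. *)
Definition coupled_solution (R : realType) (n m : nat)
    (f : 'rV[R]_n * 'rV[R]_m -> 'rV[R]_n)
    (phi : nat -> 'rV[R]_n -> 'rV[R]_n -> R -> 'rV[R]_m)
    (T : R) (k : nat) (s : nat -> R) (x0 p0 : 'rV[R]_n)
    (x p : R -> 'rV[R]_n) : Prop :=
  [/\ abs_continuous 0 T x, abs_continuous 0 T p, x 0 = x0, p 0 = p0 &
      forall j, (j <= k)%N -> ae_between (s j) (s j.+1) (fun t =>
        is_derive t 1 x (fj f phi j (x t) (p t) t) /\
        is_derive t 1 p (- (p t *m fjx f phi j (x t) (p t) t)))].

Definition adjoint_solution (R : realType) (n m : nat)
    (f : 'rV[R]_n * 'rV[R]_m -> 'rV[R]_n)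
    (phi : nat -> 'rV[R]_n -> 'rV[R]_n -> R -> 'rV[R]_m)
    (C : 'rV[R]_n -> R) (T : R) (k : nat) (s : nat -> R)
    (x p : R -> 'rV[R]_n) (y1 y2 : R -> 'rV[R]_n) : Prop :=
  [/\ abs_continuous 0 T y1, abs_continuous 0 T y2,
      y1 T = gradient C (x T), y2 T = 0 &
      forall j, (j <= k)%N -> ae_between (s j) (s j.+1) (fun t =>
        is_derive t 1 y1
          (- gradient (fun z => hamiltonian f phi j z (p t) (y1 t) (y2 t) t)
                      (x t)) /\
        is_derive t 1 y2
          (- gradient (fun q => hamiltonian f phi j (x t) q (y1 t) (y2 t) t)
                      (p t)))].

(* x(T) as a function of p0.  It takes an arbitrary value when the coupled
   system has no solution starting from (x0, p0). *)
Definition terminal_state (R : realType) (n m : nat)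
    (f : 'rV[R]_n * 'rV[R]_m -> 'rV[R]_n)
    (phi : nat -> 'rV[R]_n -> 'rV[R]_n -> R -> 'rV[R]_m)
    (T : R) (k : nat) (s : nat -> R) (x0 p0 : 'rV[R]_n) : 'rV[R]_n :=
  get [set z | exists x p,
    coupled_solution f phi T k s x0 p0 x p /\ z = x T].

(* Continuous differentiability on a set A that need not be open, with
   derivative Dchi in the first variable and Dt in the second.  Derivatives
   are taken relative to A: at times bounding A nothing is required of g on
   the other side.  If g is differentiable in the ordinary sense at the points
   of A, with a derivative continuous on A, this holds for the ordinary
   derivative. *)
Definition C1_on (R : realType) (N q : nat) (A : set ('rV[R]_N * R))
    (g : 'rV[R]_N * R -> 'rV[R]_q)
    (Dchi : 'rV[R]_N * R -> 'M[R]_(N, q)) (Dt : 'rV[R]_N * R -> 'rV[R]_q) :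
    Prop :=
  [/\ forall z, A z -> forall e : R, 0 < e ->
        \forall w \near within A (nbhs z),
          `|g w - g z - ((w.1 - z.1) *m Dchi z + (w.2 - z.2) *: Dt z)|
            <= e * `|w - z|,
      {within A, continuous Dchi} & {within A, continuous Dt}].

(* chi = (x, p) is encoded as row_mx x p. *)
Definition tube (R : realType) (n : nat) (rho a b : R) (x p : R -> 'rV[R]_n) :
    set ('rV[R]_(n + n) * R) :=
  [set z | z.2 \in `[a, b] /\ `|z.1 - row_mx (x z.2) (p z.2)| <= rho].

Definition dynamics_pair (R : realType) (n m : nat)
    (f : 'rV[R]_n * 'rV[R]_m -> 'rV[R]_n)
    (phi : nat -> 'rV[R]_n -> 'rV[R]_n -> R -> 'rV[R]_m)
    (j : nat) (z : 'rV[R]_(n + n) * R) : 'rV[R]_(n + n * n) :=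
  row_mx (fj f phi j (lsubmx z.1) (rsubmx z.1) z.2)
         (mxvec (fjx f phi j (lsubmx z.1) (rsubmx z.1) z.2)).

(* sm j and sp j are s_j^- and s_j^+.  Norms are those of the library, i.e.
   maxima of absolute values of entries; since rho and L are existentially
   quantified, any other choice of norms gives the same property. *)
Definition generalized_state_regularity (R : realType) (n m : nat)
    (f : 'rV[R]_n * 'rV[R]_m -> 'rV[R]_n)
    (phi : nat -> 'rV[R]_n -> 'rV[R]_n -> R -> 'rV[R]_m)
    (T : R) (k : nat) (s : nat -> R) (x p : R -> 'rV[R]_n) : Prop :=
  exists (rho L : R) (sm sp : nat -> R)
         (Dchi : nat -> 'rV[R]_(n + n) * R -> 'M[R]_(n + n, n + n * n))
         (Dt : nat -> 'rV[R]_(n + n) * R -> 'rV[R]_(n + n * n)),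
    [/\ 0 < rho,
        forall j, (1 <= j <= k)%N ->
          s j.-1 < sm j < s j /\ s j < sp j < s j.+1,
        sm 0%N = 0 /\ sp k.+1 = T,
        forall j, (j <= k)%N ->
          C1_on (tube rho (sm j) (sp j.+1) x p) (dynamics_pair f phi j)
                (Dchi j) (Dt j) &
        forall j, (j <= k)%N -> forall t chi chi',
          tube rho (sm j) (sp j.+1) x p (chi, t) ->
          tube rho (sm j) (sp j.+1) x p (chi', t) ->
          `|Dchi j (chi, t) - Dchi j (chi', t)| <= L * `|chi - chi'|].

(* Main.v *)
Require Import Defs.
From HB Require Import structures.
From mathcomp Require Import all_boot all_order all_algebra.
From mathcomp Require Import all_classical all_reals all_analysis.
From mathcomp Require Import ring lra.

Set Implicit Arguments.
Unset Strict Implicit.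
Unset Printing Implicit Defensive.

Import Order.TTheory GRing.Theory Num.Theory.
Import numFieldNormedType.Exports.

Local Open Scope classical_set_scope.
Local Open Scope ring_scope.

(** Write chi = (x, p); the coupled system is chi' = G_j(chi, t) with
    G_j = (f_j, - p f_jx) on (s_j, s_j+1), and the generalized Hamiltonian is
    the pairing of G_j(chi, t) with y.  By the regularity property G_j is, in
    the tube around the reference solution chibar, Lipschitz in chi and equal
    to its linearization at chibar(t) up to a quadratic error; let v A_j(t)
    denote the derivative of G_j(., t) at chibar(t) in the direction v
    ([regular_field]).

    - If chi is a solution with initial value near chibar(0), a Gronwall
      estimate keeps chi in the tube and bounds its distance to chibar by a
      multiple of the initial distance ([solution_stays_in_tube],
      [flow_estimate]); this gives uniqueness.  Existence comes from Picard
      iteration for the field truncated at the boundary of the tube, whose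
      solutions never reach that boundary ([picard_lindelof],
      [flow_exists]).
    - Let W' = W A_j, W(0) = 1.  The difference
      chi - chibar - (chi(0) - chibar(0)) W satisfies a linear inequality with
      a quadratic source, so W(T) is the derivative of chi(T) with respect to
      chi(0) ([flow_derivative], [quadratic_differentiable]).
    - The gradients of the Hamiltonian in x and p are the two halves of
      y A_j^T ([hamiltonian_gradient]), so the adjoint system reads
      y' = - y A_j^T and W y^T is constant: W(T) y(T)^T = y(0)^T
      ([adjoint_pairing]).  As y(T) = (grad C, 0), the p-rows of this identity
      are the formula for the gradient in p_0.

    Solutions are only absolutely continuous and the equations only hold
    almost everywhere.  All estimates therefore rest on [growth_bound]: an
    absolutely continuous h with |h'| <= g' almost everywhere, g nondecreasing
    and differentiable there, satisfies |h(b) - h(a)| <= g(b) - g(a).  It is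
    proved without integration, by Cousin's lemma.  The Lebesgue integral
    serves only to produce primitives of continuous functions. *)

(** * Cousin's lemma and the growth of absolutely continuous functions *)

(** A property of intervals that passes to adjacent unions and holds for all
    small intervals around each point holds for the whole interval: otherwise
    the supremum of the right ends that can be reached from a could be
    exceeded. *)
Lemma cousin (R : realType) (Q : R -> R -> Prop) (a b : R) : a <= b ->
  (forall u w v, a <= u -> u <= w -> w <= v -> v <= b ->
     Q u w -> Q w v -> Q u v) ->
  (forall t, a <= t <= b -> exists2 d : R, 0 < d & forall u v,
     a <= u -> u <= t -> t <= v -> v <= b -> t - d < u -> v < t + d -> Q u v) ->
  Q a b.
Proof.
move=> ab Qtrans Qloc.
pose S := [set x | a <= x <= b /\ Q a x].
have Sa : S a.
  split; first by rewrite lexx.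
  have [|d d0 dQ] := Qloc a; first by rewrite lexx.
  by apply: dQ => //; lra.
have Sb : ubound S b by move=> x [/andP[]].
have supS : has_sup S by split; [exists a | exists b].
set c := sup S.
have ac : a <= c by apply: sup_upper_bound.
have cb : c <= b by apply: ge_sup => //; exists a.
have [|d d0 dQ] := Qloc c; first by rewrite ac.
have [x [/andP[ax xb] Qax] cdx] := sup_adherent d0 supS.
have xc : x <= c by apply: sup_upper_bound => //; split => //; rewrite ax.
pose v := Num.min b (c + d / 2).
have cv : c <= v by rewrite /v le_min cb /=; lra.
have vb : v <= b by rewrite /v ge_min lexx.
have vd : v < c + d.
  by apply: (@le_lt_trans _ _ (c + d / 2)); [rewrite ge_min lexx orbT | lra].
have Qav : Q a v by apply: (Qtrans a x v) => //; [lra | apply: dQ].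
have : v <= c by apply: sup_upper_bound => //; split => //; rewrite vb andbT;
  lra.
rewrite /v ge_min => /orP[bc|]; last lra.
have cbE : c = b by apply/eqP; rewrite eq_le cb bc.
by move: Qav; rewrite /v min_l // -cbE; lra.
Qed.

(** The Frechet form of is_derive t 1 h d, which is the form that Cousin's
    lemma consumes. *)
Definition hasD (R : realType) (V : normedModType R) (h : R -> V) (t : R)
    (d : V) : Prop :=
  forall e : R, 0 < e ->
    \forall u \near t, `|h u - h t - (u - t) *: d| <= e * `|u - t|.

Lemma null_set_cover (R : realType) (A : set R) (d : R) :
  (@lebesgue_measure R).-negligible A -> 0 < d ->
  exists U : set R, [/\ open U, A `<=` U & (lebesgue_measure U < d%:E)%E].
Proof.
move=> [B [mB B0 AB]] d0.
have Boo : (lebesgue_measure B < +oo)%E.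
  by apply: (@le_lt_trans _ _ 0%E); rewrite ?ltry // le_eqVlt; apply/orP; left;
    apply/eqP.
have [U [oU BU UB]] := @lebesgue_regularity_outer R B d mB Boo d0.
exists U; split => //; first exact: subset_trans BU.
have mU : measurable U by exact: measurable_realfun.open_measurable.
apply: le_lt_trans UB.
rewrite -[X in (lebesgue_measure X <= _)%E](setDUK BU).
apply: (le_trans (measureU2 _ _ _)) => //; first exact: measurableD.
by apply: (@le_trans _ _ (0 + lebesgue_measure (U `\` B))%E);
  [rewrite leeD2r // le_eqVlt; apply/orP; left; apply/eqP | rewrite add0e].
Qed.

Lemma sum_disjoint_itv_le (R : realType) (U : set R) (N : nat)
    (u v : 'I_N -> R) :
  measurable U -> (forall i, u i <= v i) ->
  (forall i, [set` `]u i, v i[ ] `<=` U) ->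
  trivIset [set: 'I_N] (fun i => [set` `]u i, v i[ ]) ->
  ((\sum_i (v i - u i))%:E <= lebesgue_measure U)%E.
Proof.
move=> mU uv uvU tuv.
rewrite -sumEFin.
have -> : (\sum_(i < N) (v i - u i)%:E)%E =
    (\sum_(i < N) lebesgue_measure ([set` `]u i, v i[ ] : set R))%E.
  apply: eq_bigr => i _; rewrite lebesgue_measure_itv /=.
  case: ifPn => // /negP; rewrite lte_fin => /negP; rewrite -leNgt => vu.
  by have -> : u i = v i; [apply/eqP; rewrite eq_le uv vu | rewrite subrr].
rewrite -measure_semi_additive_ord //=.
- apply: le_measure; rewrite ?inE //=.
    by apply: bigsetU_measurable => i _; exact: measurable_itv.
  by apply: (big_ind (fun S => S `<=` U)) => // A B AU BU x [/AU|/BU].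
- by apply: bigsetU_measurable => i _; exact: measurable_itv.
Qed.

(** Where the derivatives exist with |D| <= g', the growth of h is controlled
    by that of g on intervals around the point, up to the two linearization
    errors. *)
Lemma growth_step (R : realType) (V : normedModType R) (h : R -> V)
    (g : R -> R) (t g' e u v : R) (D : V) : `|D| <= g' -> u <= t -> t <= v ->
  `|h u - h t - (u - t) *: D| <= e * `|u - t| ->
  `|h v - h t - (v - t) *: D| <= e * `|v - t| ->
  `|g u - g t - (u - t) *: (g' : R^o)| <= e * `|u - t| ->
  `|g v - g t - (v - t) *: (g' : R^o)| <= e * `|v - t| ->
  `|h v - h u| <= g v - g u + (e *+ 2) * (v - u).
Proof.
move=> Dg ut tv hu hv gu gv.
have -> : h v - h u = (h v - h t - (v - t) *: D) - (h u - h t - (u - t) *: D)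
    + (v - u) *: D.
  have -> : v - u = (v - t) - (u - t) by ring.
  rewrite [(v - t - (u - t)) *: D]scalerBl; move: ((v - t) *: D) ((u - t) *: D)
    => x y.
  have -> : h v - h t - x - (h u - h t - y) = (h v - h u) - (x - y).
    by rewrite opprD addrACA -opprD opprB subrKA.
  by rewrite subrK.
apply: (le_trans (ler_normD _ _)).
rewrite normrZ (ger0_norm (_ : 0 <= v - u)); last lra.
have n1 := ler_normB (h v - h t - (v - t) *: D) (h u - h t - (u - t) *: D).
have n2 : (v - u) * `|D| <= (v - u) * g' by apply: ler_wpM2l => //; lra.
move: gu gv hu hv n1 n2.
rewrite !ler_norml /GRing.scale /= (ger0_norm (_ : 0 <= v - t)); last lra.
rewrite (ler0_norm (_ : u - t <= 0)); last lra.
move=> /andP[g1 g2] /andP[g3 g4] h1 h2 n1 n2.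
by rewrite mulr2n; lra.
Qed.

(** Cousin's lemma with two kinds of small intervals.  Around a point where the
    derivatives exist, [growth_step] applies.  The remaining points form a null
    set and are covered by an open set U of measure below the modulus of
    absolute continuity of h; the intervals chosen around them are collected in
    a list, and their total contribution is small because they are disjoint and
    lie in U. *)
Lemma growth_bound (R : realType) (V : normedModType R) (a b : R) (h : R -> V)
    (g : R -> R) : a <= b -> abs_continuous a b h ->
  {homo g : x y / x <= y} ->
  ae_between a b (fun t => exists D g', [/\ hasD h t D,
     hasD (g : R -> R^o) t g' & `|D| <= g']) ->
  `|h b - h a| <= g b - g a.
Proof.
move=> ab ACh gmono hg; apply/ler_addgt0Pr => eps eps0.
have [d d0 dAC] := ACh _ (divr_gt0 eps0 (ltr0Sn R 1)).
set good := fun t : R => _ in hg.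
have [U [oU badU Ud]] : exists U : set R, [/\ open U,
    ~` [set t | t \in `]a, b[ -> good t] `|` ([set a] `|` [set b]) `<=` U &
    (lebesgue_measure U < d%:E)%E].
  apply: null_set_cover => //; apply: negligibleU; first exact: hg.
  by apply: negligibleU; apply/negligibleP => //; exact: lebesgue_measure_set1.
have mU : measurable U by exact: measurable_realfun.open_measurable.
(* the 1 keeps the denominator positive when a = b *)
pose e := eps / 2 / (b - a + 1).
have e0 : 0 < e by rewrite /e !divr_gt0 //; lra.
pose Q (u v : R) := exists l : seq (R * R),
  [/\ forall p, p \in l -> [/\ u <= p.1, p.1 <= p.2, p.2 <= v &
                              [set` `]p.1, p.2[ ] `<=` U],
      pairwise (fun p q : R * R => p.2 <= q.1) l &
      `|h v - h u| <= g v - g u + e * (v - u)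
                      + \sum_(p <- l) `|h p.2 - h p.1|].
have Qab : Q a b.
  apply: cousin => //.
  - move=> u w v au uw wv vb [l1 [l1P l1S hl1]] [l2 [l2P l2S hl2]].
    exists (l1 ++ l2); split.
    + by move=> p; rewrite mem_cat => /orP[/l1P|/l2P] [? ? ? ?]; split => //;
      lra.
    + rewrite pairwise_cat l1S l2S !andbT; apply/allrelP => p q.
      by move=> /l1P[? ? ? ?] /l2P[? ? ? ?]; lra.
    + rewrite big_cat /=.
      have := ler_normD (h v - h w) (h w - h u); rewrite subrKA; lra.
  - move=> t /andP[at_ tb].
    have [Ut|nUt] := pselect (U t).
      (* intervals around an exceptional point are put on the list *)
      have /nbhs_ballP[r /= r0 rU] := open_nbhs_nbhs (conj oU Ut).
      exists r => // u v au ut tv vb ru rv; exists [:: (u, v)]; split => //.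
      + move=> p; rewrite inE => /eqP -> /=; split => //; first lra.
        move=> x /=; rewrite in_itv /= => /andP[ux xv]; apply: rU.
        by rewrite /ball /= ltr_norml; lra.
      + rewrite big_seq1 /=.
        have := gmono _ _ (le_trans ut tv).
        have : 0 <= e * (v - u) by rewrite mulr_ge0 //; lra.
        lra.
    have tab : t \in `]a, b[.
      rewrite in_itv /= !lt_neqAle at_ tb !andbT; apply/andP; split.
        by apply/negP => /eqP E; apply: nUt; apply: badU; right; left.
      by apply/negP => /eqP E; apply: nUt; apply: badU; right; right.
    have [D [g' [hD gD Dg]]] : good t.
      by apply: contrapT => bt; apply: nUt; apply: badU; left => /(_ tab).
    have e20 : 0 < e / 2 by lra.
    have [r r0 rP] : exists2 r : R, 0 < r & forall u, `|u - t| < r ->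
        `|h u - h t - (u - t) *: D| <= e / 2 * `|u - t| /\
        `|g u - g t - (u - t) *: (g' : R^o)| <= e / 2 * `|u - t|.
      have /nbhs_ballP[r1 /= r10 rP1] := hD _ e20.
      have /nbhs_ballP[r2 /= r20 rP2] := gD _ e20.
      exists (Num.min r1 r2); first by rewrite lt_min r10.
      move=> u ur; have : `|t - u| < Num.min r1 r2 by rewrite distrC.
      rewrite lt_min => /andP[u1 u2].
      by split; [exact: (rP1 u u1) | exact: (rP2 u u2)].
    exists r => // u v au ut tv vb ru rv; exists [::]; split => //.
    rewrite big_nil addr0.
    have [|hu gu] := rP u; first by rewrite ltr_norml; lra.
    have [|hv gv] := rP v; first by rewrite ltr_norml; lra.
    have -> : e = (e / 2) *+ 2 by rewrite mulr2n; lra.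
    exact: (growth_step Dg ut tv hu hv gu gv).
have {Qab} [l [lP lS hl]] := Qab.
apply: (le_trans hl).
have e1 : e * (b - a) <= eps / 2.
  have : e * (b - a + 1) = eps / 2 by rewrite /e divfK // lt0r_neq0 //; lra.
  by rewrite mulrDr mulr1; lra.
suff : \sum_(p <- l) `|h p.2 - h p.1| < eps / 2 by lra.
pose P0 : R * R := (a, a).
rewrite (big_nth P0) big_mkord.
have lnth (i : 'I_(size l)) := lP _ (mem_nth P0 (ltn_ord i)).
have tl : trivIset [set: 'I_(size l)] (fun i =>
    [set` `](nth P0 l i).1, (nth P0 l i).2[ ] : set R).
  apply/trivIsetP => i j _ _ ij; apply/seteqP; split => // x [] /=.
  rewrite !in_itv /= => /andP[xi1 xi2] /andP[xj1 xj2].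
  have/(pairwiseP P0) pw := lS.
  move: ij; rewrite neq_ltn => /orP[ij|ij].
    by have := pw i j (ltn_ord i) (ltn_ord j) ij; lra.
  by have := pw j i (ltn_ord j) (ltn_ord i) ij; lra.
apply: (dAC _ (fun i => (nth P0 l i).1) (fun i => (nth P0 l i).2)) => //.
  by move=> i; have [] := lnth i.
rewrite -lte_fin; apply: le_lt_trans Ud.
by apply: sum_disjoint_itv_le => // i; have [] := lnth i.
Qed.

(** * Derivatives of matrix-valued functions and the maximum norm *)

Lemma hasD_is_derive (R : realType) (V : normedModType R) (h : R -> V) (t : R)
    (d : V) : hasD h t d <-> is_derive t 1 h d.
Proof.
split=> [hD|].
  suff hcvg : e^-1 *: ((h \o shift t) (e *: 1) - h t) @[e --> 0^'] --> d.
    apply: DeriveDef; first by apply/cvg_ex; exists d.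
    by apply: cvg_lim hcvg; exact: norm_hausdorff.
  apply/cvgrPdist_le => e e0.
  have /nbhs_ballP[r /= r0 rP] := hD _ e0.
  exists r => //= x; rewrite /ball_ /= sub0r normrN => xr x0.
  have := rP (x + t); rewrite /ball /= opprD addrCA subrr addr0 normrN.
  move=> /(_ xr) /=; rewrite addrK => hx.
  rewrite distrC /= -[in leLHS](scalerK x0 d) -scalerBr normrZ normfV.
  by rewrite ler_pdivrMl ?normr_gt0 // mulrC /GRing.scale /= mulr1.
move=> [/cvg_ex[l hl] hd] e e0.
have ld : l = d by rewrite -hd; apply/esym/cvg_lim => //; exact: norm_hausdorff.
move: hl; rewrite ld => /cvgrPdist_le /(_ _ e0)[r /= r0 rP].
apply/nbhs_ballP; exists r => //= u; rewrite /ball /= => ur.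
have [->|ut] := eqVneq u t; first by rewrite !subrr scale0r subrr !normr0 mulr0.
have ut0 : u - t != 0 by rewrite subr_eq0.
have := rP (u - t); rewrite /ball_ /= sub0r opprB => /(_ ur ut0).
rewrite /GRing.scale /= mulr1 subrK distrC => hx.
have -> : h u - h t - (u - t) *: d = (u - t) *: ((u - t)^-1 *: (h u - h t) - d).
  by rewrite scalerBr scalerA divff // scale1r.
by rewrite normrZ mulrC ler_wpM2r.
Qed.

Section HasDCalculus.
Variables (R : realType) (V : normedModType R).
Implicit Types (h : R -> V) (t : R) (d : V).

Lemma hasD_near h1 h2 t d :
  (\forall u \near t, h1 u = h2 u) -> hasD h1 t d -> hasD h2 t d.
Proof.
move=> E H e e0; have := nbhs_singleton E => Et.
by apply: filterS2 E (H _ e0) => u /= -> ; rewrite Et.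
Qed.

Lemma hasD_cst (v : V) t : hasD (fun=> v) t 0.
Proof. apply/hasD_is_derive; exact: is_derive_cst. Qed.

Lemma hasDD h1 h2 t d1 d2 : hasD h1 t d1 -> hasD h2 t d2 ->
  hasD (fun u => h1 u + h2 u) t (d1 + d2).
Proof.
by move=> /hasD_is_derive H1 /hasD_is_derive H2; apply/hasD_is_derive; exact:
  is_deriveD.
Qed.

Lemma hasDB h1 h2 t d1 d2 : hasD h1 t d1 -> hasD h2 t d2 ->
  hasD (fun u => h1 u - h2 u) t (d1 - d2).
Proof.
by move=> /hasD_is_derive H1 /hasD_is_derive H2; apply/hasD_is_derive; exact:
  is_deriveB.
Qed.

Lemma hasD_sum (I : Type) (l : seq I) (h : I -> R -> V) t (d : I -> V) :
  (forall i, hasD (h i) t (d i)) ->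
  hasD (fun u => \sum_(i <- l) h i u) t (\sum_(i <- l) d i).
Proof.
move=> H; elim: l => [|i l IH].
  rewrite big_nil; apply: hasD_near (hasD_cst 0 t).
  by near=> u; rewrite big_nil.
rewrite big_cons; apply: hasD_near (hasDD (H i) IH).
by near=> u; rewrite big_cons.
Unshelve. all: by end_near. Qed.

End HasDCalculus.

Section MatrixNorm.
Variables (R : realType).

Lemma mx_entry_le (m n : nat) (A : 'M[R]_(m, n)) i j : `|A i j| <= `|A|.
Proof.
rewrite [leRHS]/Num.Def.normr /= mx_normrE.
exact: (le_bigmax _ (fun ij : 'I_m * 'I_n => `|A ij.1 ij.2|) (i, j)).
Qed.

Lemma mx_norm_le (m n : nat) (A : 'M[R]_(m, n)) (c : R) : 0 <= c ->
  (forall i j, `|A i j| <= c) -> `|A| <= c.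
Proof.
move=> c0 Ac; rewrite [leLHS]/Num.Def.normr /= mx_normrE.
by apply: bigmax_le => // -[i j] _; exact: Ac.
Qed.

Lemma mx_norm_mul (m n p : nat) (A : 'M[R]_(m, n)) (B : 'M[R]_(n, p)) :
  `|A *m B| <= n%:R * (`|A| * `|B|).
Proof.
apply: mx_norm_le => [|i j]; first by rewrite !mulr_ge0.
rewrite mxE (le_trans (ler_norm_sum _ _ _)) //.
rewrite (le_trans (ler_sum (G := fun=> `|A| * `|B|) _ _)) //.
  by move=> k _; rewrite normrM ler_pM // mx_entry_le.
by rewrite sumr_const card_ord mulr_natl.
Qed.

Lemma mx_norm_row (m n1 n2 : nat) (A : 'M[R]_(m, n1)) (B : 'M[R]_(m, n2)) :
  `|row_mx A B| <= `|A| + `|B|.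
Proof.
apply: mx_norm_le => [|i j]; first by rewrite addr_ge0.
rewrite mxE; case: (fintype.split j) => k.
  by rewrite (le_trans (mx_entry_le _ _ _)) // lerDl.
by rewrite (le_trans (mx_entry_le _ _ _)) // lerDr.
Qed.

Lemma mx_norm_lsub (m n1 n2 : nat) (A : 'M[R]_(m, n1 + n2)) : `|lsubmx A| <=
  `|A|.
Proof. by apply: mx_norm_le => // i j; rewrite mxE mx_entry_le. Qed.

Lemma mx_norm_rsub (m n1 n2 : nat) (A : 'M[R]_(m, n1 + n2)) : `|rsubmx A| <=
  `|A|.
Proof. by apply: mx_norm_le => // i j; rewrite mxE mx_entry_le. Qed.

Lemma mx_norm_vec (m n : nat) (v : 'rV[R]_(m * n)) : `|(vec_mx v : 'M[R]_(m,
  n))| <= `|v|.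
Proof. by apply: mx_norm_le => // i j; rewrite mxE mx_entry_le. Qed.

Lemma mx_norm_tr (m n : nat) (A : 'M[R]_(m, n)) : `|A^T| = `|A|.
Proof.
apply/eqP; rewrite eq_le; apply/andP; split; apply: mx_norm_le => // i j.
  by rewrite mxE mx_entry_le.
by rewrite -[A in leLHS]trmxK mxE mx_entry_le.
Qed.

Lemma hasD_mxP (m n : nat) (h : R -> 'M[R]_(m, n)) (t : R) (d : 'M[R]_(m, n)) :
  hasD h t d <-> forall i j, hasD (fun u => h u i j) t (d i j).
Proof.
split=> [H i j e e0|H e e0].
  have := H _ e0; apply: filterS => u; apply: le_trans.
  by apply: le_trans (mx_entry_le _ i j); rewrite !mxE.
have : \forall u \near t, forall ij : 'I_m * 'I_n,
    `|h u ij.1 ij.2 - h t ij.1 ij.2 - (u - t) *: d ij.1 ij.2| <= e * `|u - t|.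
  exact: (@filter_forall _ _ _ _ (nbhs_filter t)
    (fun ij : 'I_m * 'I_n => H ij.1 ij.2 e e0)).
apply: filterS => u hu; apply: mx_norm_le => [|i j].
  by rewrite mulr_ge0 // ltW.
by have := hu (i, j); rewrite !mxE.
Qed.

Lemma hasD_mul (m n p : nat) (P : R -> 'M[R]_(m, n)) (Q : R -> 'M[R]_(n, p))
    (t : R) P' Q' : hasD P t P' -> hasD Q t Q' ->
  hasD (fun u => P u *m Q u) t (P' *m Q t + P t *m Q').
Proof.
move=> /hasD_mxP HP /hasD_mxP HQ; apply/hasD_mxP => i j.
rewrite !mxE -big_split /=.
apply: (@hasD_near _ _ (fun u => \sum_k P u i k * Q u k j)).
  by near=> u; rewrite mxE.
apply: hasD_sum => k.
have /hasD_is_derive Hp := HP i k; have /hasD_is_derive Hq := HQ k j.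
apply/hasD_is_derive; rewrite addrC [X in _ + X]mulrC.
exact: is_deriveM Hp Hq.
Unshelve. all: by end_near. Qed.

Lemma hasD_row (m n1 n2 : nat) (P : R -> 'M[R]_(m, n1)) (Q : R -> 'M[R]_(m, n2))
    (t : R) P' Q' : hasD P t P' -> hasD Q t Q' ->
  hasD (fun u => row_mx (P u) (Q u)) t (row_mx P' Q').
Proof.
move=> /hasD_mxP HP /hasD_mxP HQ; apply/hasD_mxP => i j.
rewrite mxE; case E : (fintype.split j) => [k|k].
  by apply: hasD_near (HP i k); near=> u; rewrite mxE E.
by apply: hasD_near (HQ i k); near=> u; rewrite mxE E.
Unshelve. all: by end_near. Qed.

Lemma hasD_tr (m n : nat) (P : R -> 'M[R]_(m, n)) (t : R) P' : hasD P t P' ->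
  hasD (fun u => (P u)^T) t P'^T.
Proof.
move=> /hasD_mxP HP; apply/hasD_mxP => i j.
by rewrite mxE; apply: hasD_near (HP j i); near=> u; rewrite mxE.
Unshelve. all: by end_near. Qed.

Lemma hasD_lsub (m n1 n2 : nat) (P : R -> 'M[R]_(m, n1 + n2)) (t : R) P' :
  hasD P t P' -> hasD (fun u => lsubmx (P u)) t (lsubmx P').
Proof.
move=> /hasD_mxP HP; apply/hasD_mxP => i j.
by rewrite mxE; apply: hasD_near (HP i (lshift _ j)); near=> u; rewrite mxE.
Unshelve. all: by end_near. Qed.

Lemma hasD_rsub (m n1 n2 : nat) (P : R -> 'M[R]_(m, n1 + n2)) (t : R) P' :
  hasD P t P' -> hasD (fun u => rsubmx (P u)) t (rsubmx P').
Proof.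
move=> /hasD_mxP HP; apply/hasD_mxP => i j.
by rewrite mxE; apply: hasD_near (HP i (rshift _ j)); near=> u; rewrite mxE.
Unshelve. all: by end_near. Qed.

End MatrixNorm.

(** * Absolutely continuous functions *)

Section AbsContinuous.
Variables (R : realType) (a b : R).

(** Covers all the algebraic operations below: pairs, blocks, differences and
    products on a bounded interval. *)
Lemma abs_continuous_dom (U V W : normedModType R) (K : R) (f : R -> U)
    (g : R -> V) (h : R -> W) :
  (forall u v, a <= u -> u <= v -> v <= b ->
     `|h v - h u| <= K * (`|f v - f u| + `|g v - g u|)) ->
  abs_continuous a b f -> abs_continuous a b g -> abs_continuous a b h.
Proof.
move=> hK ACf ACg e e0.
pose K1 := `|K| + 1; have K10 : 0 < K1 by rewrite ltr_wpDl.
have e1 : 0 < e / K1 / 2 by rewrite !divr_gt0.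
have [d1 d10 d1P] := ACf _ e1; have [d2 d20 d2P] := ACg _ e1.
exists (Num.min d1 d2); first by rewrite lt_min d10.
move=> N u v uv tuv; rewrite lt_min => /andP[sd1 sd2].
have sf := d1P _ _ _ uv tuv sd1; have sg := d2P _ _ _ uv tuv sd2.
apply: (@le_lt_trans _ _ (K1 * \sum_i (`|f (v i) - f (u i)| + `|g (v i) - g (u
  i)|))).
  rewrite mulr_sumr; apply: ler_sum => i _.
  have [? ? ?] := uv i; apply: (le_trans (hK _ _ _ _ _)) => //.
  rewrite ler_wpM2r ?addr_ge0 // /K1.
  by have := ler_norm K; lra.
rewrite big_split /= -ltr_pdivlMl // mulrC; lra.
Qed.

Lemma lipschitz_abs_continuous (V : normedModType R) (K : R) (h : R -> V) :
  (forall u v, a <= u -> u <= v -> v <= b -> `|h v - h u| <= K * (v - u)) ->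
  abs_continuous a b h.
Proof.
move=> hK e e0.
pose K1 := `|K| + 1; have K10 : 0 < K1 by rewrite ltr_wpDl.
exists (e / K1); first by rewrite divr_gt0.
move=> N u v uv tuv sd.
apply: (@le_lt_trans _ _ (K1 * \sum_i (v i - u i))); last first.
  by rewrite -ltr_pdivlMl // mulrC.
rewrite mulr_sumr; apply: ler_sum => i _.
have [? ? ?] := uv i; apply: (le_trans (hK _ _ _ _ _)) => //.
by rewrite ler_wpM2r ?subr_ge0 // /K1; have := ler_norm K; lra.
Qed.

Lemma abs_continuous_uniform (V : normedModType R) (h : R -> V) (e : R) :
  abs_continuous a b h -> 0 < e -> exists2 d, 0 < d &
    forall u v, a <= u <= b -> a <= v <= b -> `|v - u| < d -> `|h v - h u| < e.
Proof.
move=> ACh e0; have [d d0 dP] := ACh _ e0.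
have main u v : a <= u -> u <= v -> v <= b -> v - u < d -> `|h v - h u| < e.
  move=> au uv vb vud; have := dP 1%N (fun=> u) (fun=> v).
  rewrite !big_ord1; apply => // i j _ _ _; by rewrite !ord1.
exists d => // u v /andP[au ub] /andP[av vb].
have [uv|vu] := leP u v; first by rewrite ger0_norm ?subr_ge0 //; exact: main.
rewrite distrC ger0_norm ?subr_ge0 ?ltW // => vud.
by rewrite distrC; apply: main => //; rewrite ltW.
Qed.

(** Compactness of the segment in the form given by Cousin's lemma; F t M says
    that M is a bound at t. *)
Lemma locally_bounded_segment (F : R -> R -> Prop) : a <= b ->
  (forall t M M', M <= M' -> F t M -> F t M') ->
  (forall t, a <= t <= b -> exists2 d, 0 < d & exists M, forall u,
     a <= u <= b -> `|u - t| < d -> F u M) ->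
  exists M, forall t, a <= t <= b -> F t M.
Proof.
move=> ab Fmono Floc.
apply: (@cousin R (fun u v => exists M, forall t, u <= t <= v -> F t M) a b ab).
  move=> u w v au uw wv vb [M1 M1P] [M2 M2P]; exists (Num.max M1 M2).
  move=> t /andP[ut tv]; have [tw|wt] := leP t w.
    by apply: (Fmono _ M1); [rewrite le_max lexx | apply: M1P; rewrite ut].
  by apply: (Fmono _ M2); [rewrite le_max lexx orbT | apply: M2P; rewrite ltW].
move=> t tab; have [d d0 [M MP]] := Floc t tab.
exists d => // u v au ut tv vb du dv; exists M => r /andP[ur rv].
by apply: MP; [|rewrite ltr_norml]; lra.
Qed.

Lemma abs_continuous_bounded (V : normedModType R) (h : R -> V) : a <= b ->
  abs_continuous a b h -> exists M, forall t, a <= t <= b -> `|h t| <= M.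
Proof.
move=> ab ACh; apply: (@locally_bounded_segment (fun t M => `|h t| <= M)) => //.
  by move=> t M M' MM' /le_trans; apply.
move=> t tab; have [d d0 dP] := abs_continuous_uniform ACh ltr01.
exists d => //; exists (1 + `|h t|) => u uab ut.
by rewrite -[h u](subrK (h t)) (le_trans (ler_normD _ _)) // lerD2r ltW // dP.
Qed.

Lemma abs_continuousB (V : normedModType R) (f g : R -> V) :
  abs_continuous a b f -> abs_continuous a b g ->
  abs_continuous a b (fun t => f t - g t).
Proof.
apply: (@abs_continuous_dom _ _ _ 1) => u v _ _ _.
rewrite mul1r (_ : f v - g v - _ = (f v - f u) - (g v - g u)) ?ler_normB //.
by rewrite !opprD !opprK addrACA.
Qed.

Lemma abs_continuous_row (m n1 n2 : nat) (f : R -> 'M[R]_(m, n1))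
    (g : R -> 'M[R]_(m, n2)) : abs_continuous a b f -> abs_continuous a b g ->
  abs_continuous a b (fun t => row_mx (f t) (g t)).
Proof.
apply: (@abs_continuous_dom _ _ _ 1) => u v _ _ _.
by rewrite mul1r opp_row_mx add_row_mx mx_norm_row.
Qed.

Lemma abs_continuous_lsub (m n1 n2 : nat) (f : R -> 'M[R]_(m, n1 + n2)) :
  abs_continuous a b f -> abs_continuous a b (fun t => lsubmx (f t)).
Proof.
move=> ACf; apply: (@abs_continuous_dom _ _ _ 1 _ _ _ _ ACf ACf) => u v _ _ _.
by rewrite mul1r -linearB (le_trans (mx_norm_lsub _)) // lerDl.
Qed.

Lemma abs_continuous_rsub (m n1 n2 : nat) (f : R -> 'M[R]_(m, n1 + n2)) :
  abs_continuous a b f -> abs_continuous a b (fun t => rsubmx (f t)).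
Proof.
move=> ACf; apply: (@abs_continuous_dom _ _ _ 1 _ _ _ _ ACf ACf) => u v _ _ _.
by rewrite mul1r -linearB (le_trans (mx_norm_rsub _)) // lerDl.
Qed.

Lemma abs_continuous_tr (m n : nat) (f : R -> 'M[R]_(m, n)) :
  abs_continuous a b f -> abs_continuous a b (fun t => (f t)^T).
Proof.
move=> ACf; apply: (@abs_continuous_dom _ _ _ 1 _ _ _ _ ACf ACf) => u v _ _ _.
by rewrite mul1r -linearB mx_norm_tr lerDl.
Qed.

Lemma abs_continuous_mul (m n p : nat) (f : R -> 'M[R]_(m, n))
    (g : R -> 'M[R]_(n, p)) : a <= b ->
  abs_continuous a b f -> abs_continuous a b g ->
  abs_continuous a b (fun t => f t *m g t).
Proof.
move=> ab ACf ACg; have [Mf fM] := abs_continuous_bounded ab ACf.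
have [Mg gM] := abs_continuous_bounded ab ACg.
apply: (@abs_continuous_dom _ _ _ (n%:R * (`|Mf| + `|Mg|)) _ _ _ _ ACf ACg).
move=> u v au uv vb.
have -> : f v *m g v - f u *m g u = (f v - f u) *m g v + f u *m (g v - g u).
  by rewrite mulmxBl mulmxBr subrKA.
rewrite (le_trans (ler_normD _ _)) // (le_trans (lerD (mx_norm_mul _ _)
  (mx_norm_mul _ _))) //.
rewrite -mulrDr -mulrA ler_wpM2l //.
have gv : `|g v| <= `|Mg| by rewrite (le_trans _ (ler_norm _)) // gM //
  (le_trans au).
have fu : `|f u| <= `|Mf| by rewrite (le_trans _ (ler_norm _)) // fM // au
  (le_trans uv).
have := ler_wpM2l (normr_ge0 (f v - f u)) gv.
have := ler_wpM2r (normr_ge0 (g v - g u)) fu.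
have := mulr_ge0 (normr_ge0 Mf) (normr_ge0 (f v - f u)).
have := mulr_ge0 (normr_ge0 Mg) (normr_ge0 (g v - g u)).
lra.
Qed.

Lemma abs_continuous_sub (V : normedModType R) (h : R -> V) (a' b' : R) :
  a <= a' -> b' <= b -> abs_continuous a b h -> abs_continuous a' b' h.
Proof.
move=> aa bb ACh e e0; have [d d0 dP] := ACh e e0; exists d => // N u v uv.
by apply: dP => i; have [? ? ?] := uv i; split => //; lra.
Qed.

End AbsContinuous.

(** [growth_step] with g(t) = M t.  The derivative is only taken relative to
    the segment, so that the estimate applies along segments that touch the
    boundary of a tube. *)
Lemma mean_value_bound (R : realType) (V : normedModType R) (a b M : R)
    (h D : R -> V) : a <= b ->
  (forall t, a <= t <= b -> `|D t| <= M /\ forall e, 0 < e ->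
    \forall u \near t, a <= u <= b ->
      `|h u - h t - (u - t) *: D t| <= e * `|u - t|) ->
  `|h b - h a| <= M * (b - a).
Proof.
move=> ab hD; apply/ler_addgt0Pr => eps eps0.
pose e := eps / (b - a + 1) / 2.
have e0 : 0 < e by rewrite /e !divr_gt0 //; lra.
have Qab : `|h b - h a| <= (M + e *+ 2) * (b - a).
  apply: (@cousin R (fun u v => `|h v - h u| <= (M + e *+ 2) * (v - u))) => //.
    move=> u w v au uw wv vb h1 h2.
    by have := ler_normD (h v - h w) (h w - h u); rewrite subrKA; lra.
  move=> t tab; have [DM /(_ _ e0)/nbhs_ballP[r /= r0 rP]] := hD t tab.
  exists r => // u v au ut tv vb ru rv.
  have hu : `|h u - h t - (u - t) *: D t| <= e * `|u - t|.
    by apply: rP; [rewrite /ball /= ltr_norml|]; lra.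
  have hv : `|h v - h t - (v - t) *: D t| <= e * `|v - t|.
    by apply: rP; [rewrite /ball /= ltr_norml|]; lra.
  have g0 w : `|M * w - M * t - (w - t) *: (M : R^o)| <= e * `|w - t|.
    rewrite [_ *: _](_ : _ = (w - t) * M) //.
    have -> : M * w - M * t - (w - t) * M = 0 by ring.
    by rewrite normr0 mulr_ge0 // ltW.
  have := @growth_step _ _ _ (fun w => M * w) _ _ _ _ _ _ DM ut tv hu hv (g0 _)
    (g0 _).
  by rewrite (mulrDl M) (mulrBr M).
apply: (le_trans Qab).
have : e * (b - a + 1) = eps / 2 by rewrite /e mulrAC divfK // lt0r_neq0 //;
  lra.
by rewrite (mulr2n e); lra.
Qed.

(** * Primitives of piecewise continuous functions *)

(** The base point a only has to lie to the left of the points of interest. *)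
Lemma primitive_exists (R : realType) (c : R -> R) (a : R) : continuous c ->
  exists Q : R -> R, forall t, a < t -> hasD Q t (c t).
Proof.
move=> cc; exists (fun x => (\int[lebesgue_measure]_(t in [set` `[a, x]]) c
  t)%R).
move=> t at_.
have tt1 : t < t + 1 by lra.
have ci : lebesgue_measure.-integrable `[a, (t + 1)%R] (EFin \o c).
  apply: continuous_compact_integrable; first exact: segment_compact.
  exact: continuous_subspaceT.
have := continuous_FTC1_closed tt1 ci at_ (cc t) => /=.
move: (fun x => _) => F [dF <-].
by apply/hasD_is_derive; rewrite derive1E; exact: derivableP.
Qed.

Lemma primitive_exists_mx (R : realType) (m n : nat) (c : R -> 'M[R]_(m, n))
    (a : R) : continuous c ->
  exists Q : R -> 'M[R]_(m, n), forall t, a < t -> hasD Q t (c t).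
Proof.
move=> cc.
have /choice[Q QP] : forall ij : 'I_m * 'I_n, exists Q : R -> R,
    forall t, a < t -> hasD Q t (c t ij.1 ij.2).
  move=> [i j]; apply: primitive_exists => t /=.
  apply: (@continuous_comp _ _ _ c (fun A : 'M[R]_(m, n) => A i j)).
    exact: cc.
  exact: coord_continuous.
exists (fun t => \matrix_(i, j) Q (i, j) t) => t at_; apply/hasD_mxP => i j.
apply: hasD_near (QP (i, j) t at_).
by near=> u; rewrite mxE.
Unshelve. all: by end_near. Qed.

Section Clamp.
Variables (R : realType).
Implicit Types a b t u v : R.

Definition clamp a b t : R :=
  if t <= a then a else if b <= t then b else t.

Lemma clamp_itv a b t : a <= b -> a <= clamp a b t <= b.
Proof.
by rewrite /clamp; case: (leP t a) => ta; [|case: (leP b t) => bt]; lra.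
Qed.

Lemma clamp_id a b t : a <= t <= b -> clamp a b t = t.
Proof.
by rewrite /clamp; case: (leP t a) => ta; [|case: (leP b t) => bt]; lra.
Qed.

Lemma clamp_low a b t : t <= a -> clamp a b t = a.
Proof. by rewrite /clamp => ->. Qed.

Lemma clamp_high a b t : a <= b -> b <= t -> clamp a b t = b.
Proof.
by rewrite /clamp; case: (leP t a) => ta; [|case: (leP b t) => bt]; lra.
Qed.

Lemma clamp_incr a b u v : a <= b -> u <= v ->
  0 <= clamp a b v - clamp a b u <= v - u.
Proof.
rewrite /clamp.
by case: (leP u a) => ?; [|case: (leP b u) => ?];
   (case: (leP v a) => ?; [|case: (leP b v) => ?]); lra.
Qed.

Lemma clamp_dist a b u v : a <= b -> `|clamp a b v - clamp a b u| <= `|v - u|.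
Proof.
move=> ab; wlog uv : u v / u <= v => [H|].
  have [|vu] := leP u v; first exact: H.
  by rewrite distrC (distrC v) H // ltW.
have /andP[c0 c1] := clamp_incr ab uv.
by rewrite !ger0_norm // subr_ge0.
Qed.

Lemma clamp_continuous a b : a <= b -> continuous (clamp a b).
Proof.
move=> ab t; apply/cvgrPdist_lt => e e0; apply/nbhs_ballP; exists e => //= u.
exact: le_lt_trans (clamp_dist _ _ ab).
Qed.

End Clamp.

Lemma continuous_segment_bounded (R : realType) (V : normedModType R)
    (a b : R) (h : R -> V) : a <= b -> {within `[a, b], continuous h} ->
  exists M, forall t, a <= t <= b -> `|h t| <= M.
Proof.
move=> ab hc.
apply: (@locally_bounded_segment _ _ _ (fun t M => `|h t| <= M)) => //.
  by move=> t M M' MM' /le_trans; apply.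
move=> t tab.
have /subspace_continuousP/(_ t) := hc; rewrite /= in_itv /= tab => /(_ isT).
move=> /cvgrPdist_lt/(_ 1 ltr01)/nbhs_ballP[d /= d0 dP].
exists d => //; exists (1 + `|h t|) => u uab ut.
rewrite -[h u](subrK (h t)) (le_trans (ler_normD _ _)) // lerD2r ltW // distrC.
by apply: dP; rewrite /ball /= ?in_itv // distrC.
Qed.

Section SwitchingPoints.
Variables (R : realType) (T : R) (k : nat) (s : nat -> R).
Hypothesis sP : switching_points T k s.

Lemma switch_le i j : (i <= j <= k.+1)%N -> s i <= s j.
Proof.
have [_ _ sS] := sP; elim: j => [|j IH].
  by rewrite leqn0 => /andP[/eqP -> _].
rewrite leq_eqVlt ltnS ltnS => /andP[/orP[/eqP -> //|ij] jk].
by rewrite (le_trans (IH _)) ?ij ?(leqW jk) // ltW // sS.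
Qed.

Lemma switch_range j : (j <= k.+1)%N -> 0 <= s j <= T.
Proof.
have [s0 sT _] := sP => jk.
by rewrite -s0 -sT !switch_le ?leqnn ?jk.
Qed.

Lemma switch_lt j : (j <= k)%N -> s j < s j.+1.
Proof. by have [_ _ sS] := sP; exact: sS. Qed.

Lemma switch_sub j t : (j <= k)%N -> s j <= t <= s j.+1 -> 0 <= t <= T.
Proof.
move=> jk; have /andP[s0 _] := switch_range (leqW jk).
by have /andP[_ sT] := @switch_range j.+1 jk; lra.
Qed.

(** Primitives Q_j of the pieces are glued without recursion: composed with the
    clamp onto [s_j, s_j+1], Q_j - Q_j(s_j) is zero before the j-th piece and
    constant after it, so the sum over j has derivative c_j on the j-th piece.
      *)
Lemma piecewise_primitive (m n : nat) (c : nat -> R -> 'M[R]_(m, n)) :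
  (forall j, (j <= k)%N -> continuous (c j)) ->
  exists2 P : R -> 'M[R]_(m, n), P 0 = 0 /\
    (exists K, forall u v, u <= v -> `|P v - P u| <= K * (v - u)) &
    forall j t, (j <= k)%N -> s j < t < s j.+1 -> hasD P t (c j t).
Proof.
move=> cc.
have /choice[Q QP] : forall j, exists Q : R -> 'M[R]_(m, n),
    (j <= k)%N -> forall t, -1 < t -> hasD Q t (c j t).
  move=> j; case: (leqP j k) => [jk|_]; last by exists (fun=> 0).
  by have [Q QP] := primitive_exists_mx (-1) (cc j jk); exists Q.
have sge j : (j <= k.+1)%N -> -1 < s j.
  by move=> /switch_range/andP[s0 _]; lra.
pose P t := \sum_(j < k.+1) (Q j (clamp (s j) (s j.+1) t) - Q j (s j)).
exists P; first split.
- rewrite /P big1 // => j _; have jk := ltn_ord j; rewrite ltnS in jk.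
  have /andP[sj0 _] := switch_range (leqW jk).
  by rewrite clamp_low ?subrr.
- have /choice[M MP] : forall j, exists M, (j <= k)%N -> forall u v,
      s j <= u -> u <= v -> v <= s j.+1 -> `|Q j v - Q j u| <= M * (v - u).
    move=> j; case: (leqP j k) => [jk|_]; last by exists 0.
    have [] := @continuous_segment_bounded _ _ (s j) (s j.+1) (c j).
    + by rewrite ltW // switch_lt.
    + exact/continuous_subspaceT/cc.
    move=> M MP; exists M => _ u v su uv vs.
    apply: (@mean_value_bound _ _ _ _ _ _ (c j)) => // t /andP[ut tv]; split.
      by apply: MP; lra.
    move=> e e0; have tm1 : -1 < t by have := sge j (leqW jk); lra.
    by apply: filterS (QP j jk t tm1 e e0).
  exists (\sum_(j < k.+1) `|M j|) => u v uv.
  rewrite /P -sumrB mulr_suml (le_trans (ler_norm_sum _ _ _)) //.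
  apply: ler_sum => j _; have jk := ltn_ord j; rewrite ltnS in jk.
  have sj := ltW (switch_lt jk).
  rewrite opprB addrA subrK.
  have /andP[cu1 cu2] := clamp_itv u sj; have /andP[cv1 cv2] := clamp_itv v sj.
  have /andP[cuv cuv'] := clamp_incr sj uv.
  apply: (le_trans (MP j jk _ _ cu1 _ cv2)); first by rewrite -subr_ge0.
  by rewrite (le_trans (ler_wpM2r cuv (ler_norm _))) // ler_wpM2l.
- move=> j t jk /andP[sjt tsj].
  have -> : c j t = \sum_(i < k.+1) (if i == j :> nat then c j t else 0).
    have jk1 : (j < k.+1)%N by [].
    rewrite (bigD1 (Ordinal jk1)) //= eqxx big1 ?addr0 // => i ij.
    by case: eqP => // E; case/eqP: ij; exact: val_inj.
  apply: hasD_sum => i; have ik := ltn_ord i; rewrite ltnS in ik.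
  have si := ltW (switch_lt ik).
  case: (ltngtP i j) => [ij|ji|ij].
  + apply: hasD_near (hasD_cst (Q i (s i.+1) - Q i (s i)) t).
    have : s i.+1 <= s j by apply: switch_le; rewrite ij leqW.
    move=> sij; near=> u; rewrite clamp_high //; apply: (le_trans sij).
    by apply: ltW; near: u; exact: lt_nbhsr.
  + apply: hasD_near (hasD_cst 0 t).
    have : s j.+1 <= s i by apply: switch_le; rewrite ji leqW.
    move=> sij; near=> u; rewrite clamp_low ?subrr //; apply: le_trans sij.
    by apply: ltW; near: u; exact: lt_nbhsl.
  + have tm1 : -1 < t by have := sge j (leqW jk); lra.
    have := hasDB (QP j jk t tm1) (hasD_cst (Q j (s j)) t).
    rewrite subr0 ij; apply: hasD_near; near=> u; rewrite clamp_id //.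
    by apply/andP; split; apply: ltW; near: u; [exact: lt_nbhsr | exact:
      lt_nbhsl].
Unshelve. all: by end_near. Qed.

End SwitchingPoints.

(** * Growth and Gronwall estimates on a switched interval *)

#[local] Instance ae_lebesgue_filter (R : realType) :
  Filter (almost_everywhere (@lebesgue_measure R)).
Proof. exact: ae_filter_ringOfSetsType. Qed.

Lemma ae_betweenS (R : realType) (a b a' b' : R) (P Q : R -> Prop) :
  a' <= a -> b <= b' ->
  (forall t, a < t < b -> P t -> Q t) -> ae_between a' b' P -> ae_between a b Q.
Proof.
rewrite /ae_between => aa bb PQ; apply: filterS => t H tab.
by move: (tab); rewrite in_itv /= => tab'; apply: PQ => //; apply: H; rewrite
  in_itv /=; lra.
Qed.

Lemma ae_betweenI (R : realType) (a b : R) (P Q : R -> Prop) :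
  ae_between a b P -> ae_between a b Q -> ae_between a b (fun t => P t /\ Q t).
Proof.
rewrite /ae_between => HP HQ.
by apply: filterS2 HP HQ => t H1 H2 tab; split; [exact: H1 | exact: H2].
Qed.

Section PiecewiseGrowth.
Variables (R : realType) (T : R) (k : nat) (s : nat -> R).
Hypothesis sP : switching_points T k s.

Lemma ae_neq (a : R) : {ae @lebesgue_measure R, forall t, t != a}.
Proof.
exists [set a]; split => //; first exact: lebesgue_measure_set1.
by move=> t /= /negP; rewrite negbK => /eqP.
Qed.

(** The switching points form a null set. *)
Lemma ae_between_pieces (P : R -> Prop) :
  (forall j, (j <= k)%N -> ae_between (s j) (s j.+1) P) -> ae_between 0 T P.
Proof.
have [s0 sT _] := sP; move=> aeP.
suff H i : (i <= k.+1)%N -> ae_between 0 (s i) P by rewrite -sT; exact: H.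
elim: i => [_|i IH ik].
  by rewrite /ae_between s0; apply: aeW => t; rewrite in_itv /=; lra.
have si := switch_lt sP ik.
have := aeP i ik; have := IH (ltnW ik); rewrite /ae_between => IH1 IH2.
apply: filterS3 IH1 (ae_neq (s i)) IH2 => t H1 /eqP H2 H3; rewrite in_itv /= =>
  /andP[t0 ts].
have [tsi|sit|tsi] := ltgtP t (s i).
- by apply: H1; rewrite in_itv /= t0.
- by apply: H3; rewrite in_itv /= sit.
- by [].
Qed.

Lemma growth_pieces (V : normedModType R) (b : R) (h : R -> V) (g : R -> R) :
  0 <= b <= T -> abs_continuous 0 b h -> {homo g : x y / x <= y} ->
  (forall j, (j <= k)%N -> ae_between (s j) (s j.+1) (fun t => t < b ->
     exists D g', [/\ hasD h t D, hasD g t g' & `|D| <= g'])) ->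
  `|h b - h 0| <= g b - g 0.
Proof.
move=> /andP[b0 bT] ACh gmono /ae_between_pieces aeP.
apply: growth_bound => //; apply: ae_betweenS aeP => // t /andP[_ tb].
exact.
Qed.

Lemma hasD_exp (A L e t : R) :
  hasD (fun t => A / 2 * expR (2 * L * t) + e * t) t
       (L * (A * expR (2 * L * t)) + e).
Proof.
apply/hasD_is_derive; apply: is_derive_eq.
by rewrite /GRing.scale /=; field.
Qed.

Lemma exp_homo (A L e : R) : 0 <= A -> 0 <= L -> 0 <= e ->
  {homo (fun t => A / 2 * expR (2 * L * t) + e * t) : x y / x <= y}.
Proof.
move=> A0 L0 e0 x y xy; apply: lerD; last exact: ler_wpM2l.
by rewrite ler_wpM2l ?divr_ge0 // ler_expR ler_wpM2l // mulr_ge0.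
Qed.

(** Let S be the supremum of |h(t)| exp(- 2 L t).  Then
    |h'| <= L S exp(2 L t) + e, and integrating this bound gives
    S <= |h(0)| + e T + S / 2. *)
Lemma gronwall (V : normedModType R) (b L e : R) (h : R -> V) :
  0 <= b <= T -> 0 <= L -> 0 <= e -> abs_continuous 0 b h ->
  (forall j, (j <= k)%N -> ae_between (s j) (s j.+1) (fun t => t < b ->
     exists2 D, hasD h t D & `|D| <= L * `|h t| + e)) ->
  forall t, 0 <= t <= b -> `|h t| <= 2 * expR (2 * L * T) * (`|h 0| + e * T).
Proof.
move=> /andP[b0 bT] L0 e0 ACh hD.
have [M hM] := abs_continuous_bounded b0 ACh.
pose E t := expR (2 * L * t).
have E1 t : 0 <= t -> 1 <= E t by move=> t0; rewrite -expR0 ler_expR !mulr_ge0.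
have Epos t : 0 < E t by exact: expR_gt0.
pose W := [set w | exists2 t, 0 <= t <= b & w = `|h t| / E t].
have supW : has_sup W.
  split; first by exists (`|h 0| / E 0), 0; rewrite ?lexx ?b0.
  exists M => _ [t tb ->]; rewrite ler_pdivrMr //.
  have := hM t tb; have /andP[t0 _] := tb.
  have := E1 t t0 => E1t ht; apply: (le_trans ht).
  by rewrite ler_peMr // (le_trans _ ht).
set S := sup W.
have hS t : 0 <= t <= b -> `|h t| <= S * E t.
  by move=> tb; rewrite -ler_pdivrMr //; apply: sup_upper_bound => //; exists t.
have S0 : 0 <= S.
  have := hS 0; rewrite lexx b0 => /(_ isT); rewrite /E mulr0 expR0 mulr1.
  exact: le_trans.
have step t : 0 <= t <= b -> `|h t| <= (`|h 0| + e * T + S / 2) * E t.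
  move=> /andP[t0 tb].
  have Hg : `|h t - h 0| <= (S / 2 * E t + e * t) - (S / 2 * E 0 + e * 0).
    apply: (growth_pieces (g := fun t => S / 2 * E t + e * t)).
    - by rewrite t0 (le_trans tb).
    - exact: abs_continuous_sub ACh.
    - exact: exp_homo.
    - move=> j jk; have /andP[sj0 _] := switch_range sP (leqW jk).
      apply: ae_betweenS (hD j jk) => // r rj hr rt.
      have [D hDr Dle] := hr (lt_le_trans rt tb).
      exists D, (L * (S * E r) + e); split => //; first exact: hasD_exp.
      apply: (le_trans Dle); rewrite lerD2r ler_wpM2l // hS //.
      by move: rj; lra.
  have : `|h t| <= `|h 0| + `|h t - h 0|.
    by rewrite -{1}[h t](subrK (h 0)) addrC ler_normD.
  rewrite /E mulr0 expR0 -/(E t) in Hg.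
  have et : e * t <= e * T by rewrite ler_wpM2l // (le_trans tb).
  have : `|h 0| + e * T <= (`|h 0| + e * T) * E t.
    by rewrite ler_peMr ?E1 // addr_ge0 // mulr_ge0 // (le_trans b0).
  by lra.
have SS : S <= `|h 0| + e * T + S / 2.
  apply: ge_sup => [|_ [t tb ->]]; first by case: supW.
  by rewrite ler_pdivrMr // step.
move=> t /andP[t0 tb].
have ht : `|h t| <= S * E t by rewrite hS // t0.
have Et : E t <= E T by rewrite ler_expR ler_wpM2l ?mulr_ge0 // (le_trans tb).
apply: (le_trans ht); rewrite -/(E T).
apply: (@le_trans _ _ (S * E T)); first by rewrite ler_wpM2l.
by rewrite mulrAC; apply: ler_wpM2r; [exact: ltW | lra].
Qed.

End PiecewiseGrowth.

(** * Picard iteration for switched systems *)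

Lemma geometric_small (R : realType) (C e : R) : 0 < e ->
  exists n : nat, C / 2 ^+ n < e.
Proof.
move=> e0; have [n Cn] : exists n : nat, C / e < n%:R.
  exists (Num.bound `|C / e|).
  exact: le_lt_trans (ler_norm _) (archi_boundP (normr_ge0 _)).
exists n; rewrite ltr_pdivrMr ?exprn_gt0 // -ltr_pdivrMl // mulrC.
by rewrite (lt_trans Cn) // -natrX ltr_nat ltn_expl.
Qed.

Lemma geometric_cvg (R : realType) (p q : nat) (v : nat -> 'M[R]_(p, q))
    (C : R) : 0 <= C -> (forall n, `|v n.+1 - v n| <= C / 2 ^+ n) ->
  exists l, forall n, `|v n - l| <= 2 * C / 2 ^+ n.
Proof.
move=> C0 vC.
have vm n m : `|v (n + m)%N - v n| <= 2 * C / 2 ^+ n - 2 * C / 2 ^+ (n + m).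
  elim: m => [|m IH]; first by rewrite addn0 !subrr normr0.
  have := ler_normD (v (n + m.+1)%N - v (n + m)%N) (v (n + m)%N - v n).
  rewrite subrKA => /le_trans; apply; rewrite addnS.
  have := vC (n + m)%N; have -> : C / 2 ^+ (n + m) =
     2 * C / 2 ^+ (n + m) - 2 * C / 2 ^+ (n + m).+1.
    by rewrite exprS; field; rewrite expf_neq0.
  lra.
have vm' n m : (n <= m)%N -> `|v m - v n| <= 2 * C / 2 ^+ n.
  move=> nm; rewrite -(subnKC nm); apply: (le_trans (vm _ _)).
  by rewrite lerBlDr lerDl !mulr_ge0 ?invr_ge0 ?exprn_ge0.
have vcvg : cvg (v @ \oo).
  apply: cauchy_cvg; apply/cauchy_exP => e e0.
  have [n ne] := geometric_small (2 * C) e0.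
  exists (v n); exists n => // m /= nm; rewrite -ball_normE /= distrC.
  exact: le_lt_trans (vm' n m nm) ne.
exists (lim (v @ \oo)) => n; apply/ler_addgt0Pr => e e0.
have /cvgrPdist_lt/(_ e e0)[N _ NP] := vcvg.
have := NP (maxn n N); rewrite /= leq_maxr => /(_ isT) vl.
have := vm' n (maxn n N) (leq_maxl _ _); rewrite distrC => vn.
rewrite -(subrKA (v (maxn n N))) (le_trans (ler_normD _ _)) // lerD //.
by rewrite distrC ltW.
Qed.

Section Picard.
Variables (R : realType) (T : R) (k : nat) (s : nat -> R).
Hypothesis sP : switching_points T k s.

(** Measured with the weight exp(- 2 L t), the distance between consecutive
    iterates is at least halved at each step, so the iteration converges on the
    whole of [0, T] at once. *)
Lemma picard_lindelof (m n : nat) (G : nat -> 'M[R]_(m, n) -> R -> 'M[R]_(m,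
  n)) (L : R)
    (x0 : 'M[R]_(m, n)) : 0 <= L ->
  (forall j (c : R -> 'M[R]_(m, n)), (j <= k)%N -> continuous c -> continuous
    (fun t => G j (c t) t)) ->
  (forall j x y t, (j <= k)%N -> s j < t < s j.+1 ->
     `|G j x t - G j y t| <= L * `|x - y|) ->
  exists chi : R -> 'M[R]_(m, n), [/\ abs_continuous 0 T chi, chi 0 = x0 &
    forall j t, (j <= k)%N -> s j < t < s j.+1 -> hasD chi t (G j (chi t) t)].
Proof.
move=> L0 Gc GL.
have T0 : 0 <= T by have := switch_range sP (leqnn k.+1); lra.
have /choice[F FP] : forall c : R -> 'M[R]_(m, n),
    exists P : R -> 'M[R]_(m, n), continuous c -> [/\ P 0 = x0,
    exists K, forall u v, u <= v -> `|P v - P u| <= K * (v - u) &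
    forall j t, (j <= k)%N -> s j < t < s j.+1 -> hasD P t (G j (c t) t)].
  move=> c; have [cc|nc] := pselect (continuous c); last by exists (fun=> 0).
  have [P [P0 [K PK]] PD] := piecewise_primitive sP (fun j jk => Gc j c jk cc).
  exists (fun t => x0 + P t) => _; split; first by rewrite P0 addr0.
    by exists K => u v uv; rewrite opprD addrACA subrr add0r PK.
  by move=> j t jk tj; rewrite -[G _ _ _]add0r; apply: hasDD;
    [exact: hasD_cst | exact: PD].
have Fcont c : continuous c -> continuous (F c).
  move=> cc; have [_ [K FK] _] := FP c cc.
  have dist u v : `|F c v - F c u| <= `|K| * `|v - u|.
    wlog uv : u v / u <= v => [H|].
      have [|vu] := leP u v; first exact: H.
      by rewrite distrC (distrC v) H // ltW.
    rewrite (ger0_norm (_ : 0 <= v - u)) ?subr_ge0 // (le_trans (FK _ _ uv)) //.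
    by rewrite ler_wpM2r ?subr_ge0 // ler_norm.
  move=> t; apply/cvgrPdist_lt => e e0; apply/nbhs_ballP.
  exists (e / (`|K| + 1)) => [/=|u]; first by rewrite divr_gt0 // ltr_wpDl.
  rewrite /ball /= ltr_pdivlMr ?ltr_wpDl // mulrDr mulr1 mulrC => ut.
  by have := dist u t; have := normr_ge0 (t - u); lra.
have FAC c : continuous c -> abs_continuous 0 T (F c).
  move=> cc; have [_ [K FK] _] := FP c cc.
  by apply: (@lipschitz_abs_continuous _ _ _ _ K) => u v _ uv _; exact: FK.
(* two iterates compared through their integrands *)
have Fdiff (c1 c2 : R -> 'M[R]_(m, n)) (b : R) (g : R -> R) (g' : R -> R) :
  continuous c1 -> continuous c2 ->
    0 <= b <= T -> {homo g : x y / x <= y} -> (forall t, hasD g t (g' t)) ->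
    (forall t, 0 <= t <= T -> L * `|c1 t - c2 t| <= g' t) ->
    `|F c1 b - F c2 b| <= g b - g 0.
  move=> cc1 cc2 bT gm gD gL.
  have [F10 _ F1D] := FP _ cc1; have [F20 _ F2D] := FP _ cc2.
  have -> : F c1 b - F c2 b = (F c1 b - F c2 b) - (F c1 0 - F c2 0).
    by rewrite F10 F20 subrr subr0.
  apply: (growth_pieces sP (h := fun t => F c1 t - F c2 t) bT) => //.
    apply: (@abs_continuous_sub _ 0 T) => //; first by have := bT; lra.
    exact: abs_continuousB (FAC _ cc1) (FAC _ cc2).
  move=> j jk; apply: aeW => t; rewrite in_itv /= => tj _.
  exists (G j (c1 t) t - G j (c2 t) t), (g' t); split => //.
    by apply: hasDB; [exact: F1D | exact: F2D].
  apply: (le_trans (GL _ _ _ _ jk tj)); apply: gL.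
  by apply: (switch_sub sP jk); lra.
pose u := fix u i := if i is i'.+1 then F (u i') else fun=> x0.
have uc i : continuous (u i).
  by elim: i => [|i IH] /=; [exact: cst_continuous | exact: Fcont].
have [A uA] : exists A, forall t, 0 <= t <= T -> `|u 1%N t - u 0%N t| <= A.
  apply: abs_continuous_bounded => //; apply: abs_continuousB.
    exact: (FAC _ (uc 0%N)).
  by apply: (@lipschitz_abs_continuous _ _ _ _ 0) => *; rewrite subrr normr0
    mul0r.
have A0 : 0 <= A by apply: le_trans (uA 0 _) => //; rewrite lexx.
pose E t := expR (2 * L * t).
have E1 t : 0 <= t -> 1 <= E t by move=> t0; rewrite -expR0 ler_expR !mulr_ge0.
have uE i : forall t, 0 <= t <= T -> `|u i.+1 t - u i t| <= A / 2 ^+ i * E t.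
  elim: i => [|i IH] t tT.
    rewrite expr0 divr1 (le_trans (uA t tT)) // ler_peMr //.
    by apply: E1; have := tT; lra.
  set B := A / 2 ^+ i; have B0 : 0 <= B by rewrite divr_ge0 ?exprn_ge0.
  have := @Fdiff (u i.+1) (u i) t (fun t => B / 2 * E t + 0 * t)
    (fun t => L * (B * E t) + 0) (uc _) (uc _) tT (exp_homo B0 L0 (lexx 0)).
  move=> /(_ (hasD_exp _ _ _)) H.
  apply: (le_trans (H _)) => [r rT|]; first by rewrite addr0 ler_wpM2l // IH.
  have -> : A / 2 ^+ i.+1 = B / 2 by rewrite /B exprS invfM mulrCA mulrC.
  have : 0 <= B / 2 * E 0 by rewrite !mulr_ge0 // expR_ge0.
  by rewrite !mul0r; lra.
pose C := A * E T.
have C0 : 0 <= C by rewrite mulr_ge0 // expR_ge0.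
have /choice[l lP] : forall t, exists l, 0 <= t <= T ->
    forall i, `|u i t - l| <= 2 * C / 2 ^+ i.
  move=> t; have [tT|nt] := pselect (0 <= t <= T); last by exists 0.
  have [i|l lP] := @geometric_cvg _ _ _ (fun i => u i t) C C0.
    apply: (le_trans (uE i t tT)); rewrite /C mulrAC ler_wpM2r //.
    by rewrite ler_wpM2l // ler_expR ler_wpM2l ?mulr_ge0 //; have := tT; lra.
  by exists l.
(* the limit is only controlled on [0, T]; F needs a path on the whole line *)
pose c t := l (clamp 0 T t).
have cP t : 0 <= t <= T -> c t = l t by move=> tT; rewrite /c clamp_id.
have cc : continuous c.
  move=> t; apply/cvgrPdist_lt => e e0.
  have e3 : 0 < e / 3 by rewrite divr_gt0.
  have [i iP] := geometric_small (2 * C) e3.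
  have : {for t, continuous (fun t => u i (clamp 0 T t))}.
    by apply: continuous_comp; [exact: clamp_continuous | exact: uc].
  move=> /cvgrPdist_lt/(_ _ e3); apply: filterS => r /= ur.
  have := lP _ (clamp_itv t T0) i; have := lP _ (clamp_itv r T0) i.
  rewrite -/(c t) -/(c r) => lr lt.
  have := ler_normD (c t - u i (clamp 0 T t)) (u i (clamp 0 T t) - c r).
  have := ler_normD (u i (clamp 0 T t) - u i (clamp 0 T r)) (u i (clamp 0 T r)
    - c r).
  by rewrite distrC in lt; rewrite !subrKA; lra.
have [F0 _ FD] := FP c cc.
(* the limit c of the iterates is a fixed point of F on [0, T] *)
have cF t : 0 <= t <= T -> F c t = c t.
  move=> tT; apply/eqP; rewrite -subr_eq0 -normr_le0; apply/ler_addgt0Pr => e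
    e0; rewrite add0r.
  have [i iP] := geometric_small (2 * C * (L * T + 1)) e0.
  set w := 2 * C / 2 ^+ i; have w0 : 0 <= w by apply: divr_ge0; [exact:
    mulr_ge0 | exact: exprn_ge0].
  have h1 : `|F c t - F (u i) t| <= L * w * t - L * w * 0.
    apply: (@Fdiff c (u i) t (fun t => L * w * t) (fun=> L * w)) => //.
    - by move=> x y xy; rewrite ler_wpM2l // mulr_ge0.
    - move=> r; apply/hasD_is_derive; apply: is_derive_eq.
      by rewrite /GRing.scale /= mulr1.
    - by move=> r rT; rewrite ler_wpM2l // distrC cP // lP.
  have h2 : `|F (u i) t - c t| <= w.
    rewrite cP //; apply: (le_trans (lP t tT i.+1)).
    have -> : 2 * C / 2 ^+ i.+1 = w / 2 by rewrite /w exprS invfM mulrCA mulrC.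
    by move: w0; lra.
  have := ler_normD (F c t - F (u i) t) (F (u i) t - c t); rewrite subrKA.
  have : L * w * t <= L * w * T.
    by case/andP: tT => _ tT; apply: ler_wpM2l => //; exact: mulr_ge0.
  have : 2 * C * (L * T + 1) / 2 ^+ i = L * w * T + w.
    by rewrite /w; field; rewrite expf_neq0.
  lra.
exists (F c); split => //; first exact: FAC.
move=> j t jk tj; have := FD j t jk tj; rewrite cF //.
by apply: (switch_sub sP jk); lra.
Qed.

End Picard.

(** * The flow of a switched system near a reference solution *)

Lemma mulmx_continuous (R : realType) (m n p : nat) (f : R -> 'M[R]_(m, n))
    (g : R -> 'M[R]_(n, p)) : continuous f -> continuous g ->
  continuous (fun t => f t *m g t).
Proof.
move=> cf cg t; apply/cvgrPdist_le => e e0.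
pose C := n%:R * (1 + `|f t| + `|g t|) + 1.
have C0 : 0 < C by rewrite ltr_wpDl // mulr_ge0 // !addr_ge0.
have e1 : 0 < Num.min 1 (e / C) by rewrite lt_min ltr01 divr_gt0.
have /cvgrPdist_le/(_ _ e1) fnear := cf t.
have /cvgrPdist_le/(_ _ e1) gnear := cg t.
apply: filterS2 fnear gnear => u /=.
rewrite !le_min => /andP[f1 fe] /andP[_ ge].
have -> : f t *m g t - f u *m g u = (f t - f u) *m g t + f u *m (g t - g u).
  by rewrite mulmxBl mulmxBr subrKA.
apply: (le_trans (ler_normD _ _)).
apply: (le_trans (lerD (mx_norm_mul _ _) (mx_norm_mul _ _))).
have fu : `|f u| <= 1 + `|f t|.
  rewrite -[f u](subrK (f t)) (le_trans (ler_normD _ _)) // lerD2r //.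
  by rewrite distrC.
have m1 := ler_pM (normr_ge0 _) (normr_ge0 (g t)) fe (lexx _).
have m2 := ler_pM (normr_ge0 (f u)) (normr_ge0 _) fu ge.
rewrite -mulrDr; apply: (le_trans (ler_wpM2l (ler0n _ _) (lerD m1 m2))).
have ec : 0 <= e / C by rewrite divr_ge0 // ltW.
have : e / C * C = e by rewrite divfK // lt0r_neq0.
rewrite {2}/C; lra.
Qed.

Lemma lipschitz_continuous (R : realType) (U V : normedModType R) (f : U -> V)
    (K : R) : (forall x y, `|f x - f y| <= K * `|x - y|) -> continuous f.
Proof.
move=> fK x; apply/cvgrPdist_lt => e e0.
have K0 : 0 < `|K| + 1 by rewrite ltr_wpDl.
apply/nbhs_normP; exists (e / (`|K| + 1)) => /=; first by rewrite divr_gt0.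
move=> y; rewrite /= ltr_pdivlMr // => xy; apply: le_lt_trans xy.
rewrite (le_trans (fK x y)) // mulrC ler_wpM2l //.
by rewrite (le_trans (ler_norm K)) // lerDl.
Qed.

Lemma lipschitz1_continuous (R : realType) (U V : normedModType R) (f : U -> V)
  :
  (forall x y, `|f x - f y| <= `|x - y|) -> continuous f.
Proof.
by move=> fL; apply: (@lipschitz_continuous _ _ _ _ 1) => x y; rewrite mul1r.
Qed.

(** Makes f continuous on the whole line without changing it on [a, b], so that
    paths built from f have primitives. *)
Lemma abs_continuous_clamp (R : realType) (V : normedModType R) (T a b : R)
    (f : R -> V) : 0 <= a -> a <= b -> b <= T -> abs_continuous 0 T f ->
  continuous (fun t => f (clamp a b t)).
Proof.
move=> a0 ab bT ACf t; apply/cvgrPdist_lt => e e0.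
have [d d0 dP] := abs_continuous_uniform ACf e0.
apply/nbhs_normP; exists d => //= u tu.
have := clamp_itv u ab; have := clamp_itv t ab => /andP[? ?] /andP[? ?].
by apply: dP; rewrite ?(le_lt_trans (clamp_dist _ _ ab)) //; lra.
Qed.

Section BoxClamp.
Variables (R : realType) (m n : nat) (rho : R).
Hypothesis rho0 : 0 < rho.
Implicit Types x y : 'M[R]_(m, n).

(** For the maximum norm this is a 1-Lipschitz retraction onto the ball of
    radius rho. *)
Definition box_clamp x := map_mx (clamp (- rho) rho) x.

Lemma box_clamp_le x : `|box_clamp x| <= rho.
Proof.
apply: mx_norm_le => [|i j]; first exact: ltW.
by rewrite mxE ler_norml clamp_itv //; have := rho0; lra.
Qed.

Lemma box_clamp_dist x y : `|box_clamp x - box_clamp y| <= `|x - y|.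
Proof.
apply: mx_norm_le => // i j; rewrite !mxE.
apply: le_trans (clamp_dist _ _ _) _; first by have := rho0; lra.
by apply: le_trans (mx_entry_le _ i j); rewrite !mxE.
Qed.

Lemma box_clamp_id x : `|x| <= rho -> box_clamp x = x.
Proof.
move=> xr; apply/matrixP => i j; rewrite mxE clamp_id // -ler_norml.
exact: le_trans (mx_entry_le _ _ _) xr.
Qed.

End BoxClamp.

Definition piecewise_solution (R : realType) (V : normedModType R) (T : R)
    (k : nat) (s : nat -> R) (G : nat -> V -> R -> V) (chi : R -> V) : Prop :=
  abs_continuous 0 T chi /\ forall j, (j <= k)%N ->
    ae_between (s j) (s j.+1) (fun t => hasD chi t (G j (chi t) t)).

Section Flow.
Variables (R : realType) (T : R) (k : nat) (s : nat -> R).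
Hypothesis sP : switching_points T k s.
Variables (N : nat) (G : nat -> 'rV[R]_N -> R -> 'rV[R]_N).
Variables (chib : R -> 'rV[R]_N) (rho L : R).
Hypotheses (rho0 : 0 < rho) (L0 : 0 <= L).
Hypothesis chib_sol : piecewise_solution T k s G chib.
Hypothesis G_cont : forall j (c : R -> 'rV[R]_N), (j <= k)%N -> continuous c ->
  (forall t, `|c t - chib (clamp (s j) (s j.+1) t)| <= rho) ->
  continuous (fun t => G j (c t) (clamp (s j) (s j.+1) t)).
Hypothesis G_lip : forall j x y t, (j <= k)%N -> s j <= t <= s j.+1 ->
  `|x - chib t| <= rho -> `|y - chib t| <= rho ->
  `|G j x t - G j y t| <= L * `|x - y|.

Local Notation E := (2 * expR (2 * L * T)).

Let T0 : 0 <= T.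
Proof. by have := switch_range sP (leqnn k.+1); lra. Qed.

Let E_gt0 : 0 < E.
Proof. by rewrite mulr_gt0 // expR_gt0. Qed.

(** G_j evaluated at the projection of x onto the tube around chib, with time
    clamped to the j-th piece. *)
Definition truncated_field j (x : 'rV[R]_N) t :=
  let r := clamp (s j) (s j.+1) t in G j (chib r + box_clamp rho (x - chib r))
    r.

Lemma truncated_solution q : exists chi : R -> 'rV[R]_N,
  [/\ abs_continuous 0 T chi, chi 0 = q &
    forall j t, (j <= k)%N -> s j < t < s j.+1 ->
      hasD chi t (truncated_field j (chi t) t)].
Proof.
apply: (picard_lindelof sP q L0) => [j c jk cc|j x y t jk tj].
  have sj := ltW (switch_lt sP jk).
  have bc : continuous (fun t => chib (clamp (s j) (s j.+1) t)).
    apply: (@abs_continuous_clamp _ _ T) => //; last by have [] := chib_sol.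
      by have := switch_range sP (leqW jk); lra.
    by have := @switch_range _ _ _ _ sP j.+1 jk; lra.
  apply: G_cont => // [|t]; last by rewrite addrAC subrr add0r box_clamp_le.
  move=> t; apply: cvgD; first exact: bc.
  apply: (@continuous_comp _ _ _
      (fun t => c t - chib (clamp (s j) (s j.+1) t)) (box_clamp rho)).
    by apply: cvgB; [exact: cc | exact: bc].
  by apply: lipschitz1_continuous; exact: box_clamp_dist.
rewrite /truncated_field clamp_id; last by lra.
apply: le_trans (G_lip jk _ _ _) _; first by lra.
- by rewrite addrAC subrr add0r box_clamp_le.
- by rewrite addrAC subrr add0r box_clamp_le.
rewrite ler_wpM2l // opprD addrACA subrr add0r.
by apply: le_trans (box_clamp_dist rho0 _ _) _; rewrite opprB subrKA.
Qed.

(** Gronwall for the difference of two functions whose derivatives are values of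
    the field at points x, y of the tube that need not lie on the curves but are
    no farther apart; this form serves solutions of the truncated field as
      well. *)
Lemma tube_estimate b chi chi' : 0 <= b <= T ->
  abs_continuous 0 T chi -> abs_continuous 0 T chi' ->
  (forall j, (j <= k)%N -> ae_between (s j) (s j.+1) (fun t => t < b ->
     exists x y, [/\ hasD chi t (G j x t), hasD chi' t (G j y t),
       `|x - chib t| <= rho, `|y - chib t| <= rho &
       `|x - y| <= `|chi t - chi' t|])) ->
  forall t, 0 <= t <= b -> `|chi t - chi' t| <= E * `|chi 0 - chi' 0|.
Proof.
move=> bT AC1 AC2 H t tb.
have := @gronwall _ _ _ _ sP _ b L 0 (fun t => chi t - chi' t) bT L0 (lexx 0).
rewrite mul0r addr0; apply => //.
  apply: (@abs_continuous_sub _ 0 T) => //; first by have := bT; lra.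
  exact: abs_continuousB.
move=> j jk; apply: ae_betweenS (H j jk) => // r rj Hr rb.
have [x [y [D1 D2 hx hy xy]]] := Hr rb.
exists (G j x r - G j y r); first exact: hasDB.
rewrite addr0; apply: (le_trans (G_lip jk _ hx hy)); first by lra.
exact: ler_wpM2l.
Qed.

(** Cousin's lemma for the implication: strictly inside the tube up to time u
    implies strictly inside up to time v.  While inside, [tube_estimate] bounds
    the distance to chib by E times its initial value, which is strictly below
    rho, so a continuous solution cannot jump to distance rho. *)
Lemma solution_stays_in_tube chi : piecewise_solution T k s G chi ->
  E * `|chi 0 - chib 0| < rho ->
  forall t, 0 <= t <= T -> `|chi t - chib t| <= rho.
Proof.
move=> [ACc chiD] small; have [ACb chibD] := chib_sol.
pose Q (u v : R) := (forall t, 0 <= t <= u -> `|chi t - chib t| < rho) ->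
  (forall t, 0 <= t <= v -> `|chi t - chib t| < rho).
suff Q0T : Q 0 T.
  move=> t tT; apply: ltW; apply: Q0T => // r; rewrite -eq_le => /eqP <-.
  apply: le_lt_trans small; rewrite ler_peMl //.
  have : 1 <= expR (2 * L * T) by rewrite -expR0 ler_expR !mulr_ge0.
  lra.
apply: cousin => //; first by move=> u w v *; rewrite /Q; auto.
move=> t tT.
have ACd := abs_continuousB ACc ACb.
have [lt_rho|ge_rho] := ltP `|chi t - chib t| rho.
  have [|d d0 dP] := abs_continuous_uniform ACd (e := rho - `|chi t - chib t|).
    by rewrite subr_gt0.
  exists d => // u v u0 ut tv vT du dv Hu r /andP[r0 rv].
  have [ru|ur] := leP r u; first by apply: Hu; rewrite r0.
  have : `|(chi r - chib r) - (chi t - chib t)| < rho - `|chi t - chib t|.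
    by apply: dP; rewrite ?ltr_norml; have := tT; lra.
  have := ler_normD ((chi r - chib r) - (chi t - chib t)) (chi t - chib t).
  by rewrite subrK; lra.
have [|d d0 dP] := abs_continuous_uniform ACd (e := rho - E * `|chi 0 - chib
  0|).
  by rewrite subr_gt0.
exists d => // u v u0 ut tv vT du dv Hu; exfalso.
have uT : 0 <= u <= T by have := tT; lra.
have : `|chi u - chib u| <= E * `|chi 0 - chib 0|.
  apply: (@tube_estimate u) => // [j jk|]; last by rewrite u0 lexx.
  apply: ae_betweenS (ae_betweenI (chiD j jk) (chibD j jk)) => // r rj [D1 D2]
    ru.
  exists (chi r), (chib r); split => //; last by rewrite subrr normr0 ltW.
  apply: ltW; apply: Hu; have := switch_range sP (leqW jk); lra.
have : `|(chi t - chib t) - (chi u - chib u)| < rho - E * `|chi 0 - chib 0|.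
  by apply: dP; rewrite ?ltr_norml; have := tT; lra.
have := ler_normD ((chi t - chib t) - (chi u - chib u)) (chi u - chib u).
by rewrite subrK; lra.
Qed.

(** A solution of the truncated field stays so close to chib that the truncation
    is never active. *)
Lemma flow_exists q : E * `|q - chib 0| < rho -> exists2 chi,
  piecewise_solution T k s G chi & chi 0 = q.
Proof.
move=> small; have [chi [ACc c0 cD]] := truncated_solution q.
have [ACb bD] := chib_sol.
exists chi; last exact: c0.
split=> [|j jk]; first exact: ACc.
have est : forall t, 0 <= t <= T -> `|chi t - chib t| <= E * `|chi 0 - chib 0|.
  apply: tube_estimate => //; first by rewrite lexx T0.
  move=> i ik; apply: ae_betweenS (bD i ik) => // r ri D _.
  exists (chib r + box_clamp rho (chi r - chib r)), (chib r); split => //.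
  - have := cD i r ik ri; rewrite /truncated_field clamp_id //; lra.
  - by rewrite addrAC subrr add0r box_clamp_le.
  - by rewrite subrr normr0 ltW.
  - have := box_clamp_dist rho0 (chi r - chib r) 0.
    have -> : box_clamp rho (0 : 'rV[R]_N) = 0.
      by apply: box_clamp_id; rewrite normr0 ltW.
    by rewrite !subr0 [X in _ -> `|X| <= _]addrAC subrr add0r.
apply: aeW => t; rewrite in_itv /= => tj.
have tT : 0 <= t <= T by apply: (switch_sub sP jk); lra.
have := cD j t jk tj; rewrite /truncated_field clamp_id; last by lra.
rewrite box_clamp_id ?subrKC //.
by apply: (le_trans (est t tT)); rewrite c0 ltW.
Qed.

Lemma flow_estimate chi chi' :
  piecewise_solution T k s G chi -> piecewise_solution T k s G chi' ->
  E * `|chi 0 - chib 0| < rho -> E * `|chi' 0 - chib 0| < rho ->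
  forall t, 0 <= t <= T -> `|chi t - chi' t| <= E * `|chi 0 - chi' 0|.
Proof.
move=> sol sol' small small'.
have tube1 := solution_stays_in_tube sol small.
have tube2 := solution_stays_in_tube sol' small'.
have [ACc cD] := sol; have [ACc' cD'] := sol'.
apply: tube_estimate => //; first by rewrite lexx T0.
move=> j jk; apply: ae_betweenS (ae_betweenI (cD j jk) (cD' j jk)) => //.
move=> t tj [D1 D2] _; have tT : 0 <= t <= T by apply: (switch_sub sP jk); lra.
by exists (chi t), (chi' t); split => //; [exact: tube1 | exact: tube2].
Qed.

Variables (A : nat -> R -> 'M[R]_N) (K : R).
Hypothesis K0 : 0 <= K.
Hypothesis A_cont : forall j, (j <= k)%N ->
  continuous (fun t => A j (clamp (s j) (s j.+1) t)).
Hypothesis A_bound : forall j t, (j <= k)%N -> s j <= t <= s j.+1 ->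
  N%:R * `|A j t| <= L.
Hypothesis G_taylor : forall j x t, (j <= k)%N -> s j < t < s j.+1 ->
  `|x - chib t| <= rho ->
  `|G j x t - G j (chib t) t - (x - chib t) *m A j t| <= K * `|x - chib t| ^+ 2.

(** The fundamental matrix of v' = v A_j, acting on row vectors. *)
Lemma variational_matrix : exists W : R -> 'M[R]_N,
  [/\ abs_continuous 0 T W, W 0 = 1%:M &
    forall j t, (j <= k)%N -> s j < t < s j.+1 -> hasD W t (W t *m A j t)].
Proof.
have [j c jk cc|j X Y t jk tj|W [ACW W0 WD]] :=
    @picard_lindelof _ _ _ _ sP N N (fun j X t => X *m A j (clamp (s j) (s
      j.+1) t)) L
      1%:M L0.
- exact: mulmx_continuous (A_cont jk).
- rewrite -mulmxBl clamp_id; last by lra.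
  apply: (le_trans (mx_norm_mul _ _)).
  by rewrite mulrCA mulrC ler_wpM2r // A_bound //; lra.
- exists W; split => // j t jk tj; have := WD j t jk tj.
  by rewrite clamp_id //; lra.
Qed.

(** The error chi - chib - (chi(0) - chib(0)) W vanishes at 0 and has derivative
    (error) A_j plus the Taylor remainder of the field, which is quadratic in
    chi - chib, hence in chi(0) - chib(0) by [flow_estimate]. *)
Lemma flow_derivative W : abs_continuous 0 T W -> W 0 = 1%:M ->
  (forall j t, (j <= k)%N -> s j < t < s j.+1 -> hasD W t (W t *m A j t)) ->
  forall chi, piecewise_solution T k s G chi ->
  E * `|chi 0 - chib 0| < rho ->
  `|chi T - chib T - (chi 0 - chib 0) *m W T|
    <= E * (K * E ^+ 2 * T) * `|chi 0 - chib 0| ^+ 2.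
Proof.
move=> ACW W0 WD chi sol small.
have [ACc cD] := sol; have [ACb bD] := chib_sol.
set d := chi 0 - chib 0 in small *.
have near0 t : 0 <= t <= T -> `|chi t - chib t| <= E * `|d|.
  apply: flow_estimate => //.
  by rewrite subrr normr0 mulr0.
pose h t := chi t - chib t - d *m W t.
have h0 : h 0 = 0 by rewrite /h W0 mulmx1 subrr.
have ACh : abs_continuous 0 T h.
  apply: abs_continuousB; first exact: abs_continuousB.
  apply: abs_continuous_mul => //.
  by apply: (@lipschitz_abs_continuous _ _ _ _ 0) => *; rewrite subrr normr0
    mul0r.
have e0 : 0 <= K * (E * `|d|) ^+ 2 by rewrite mulr_ge0 // exprn_ge0 // mulr_ge0
  // ltW.
have TT : 0 <= T <= T by rewrite lexx T0.
have := @gronwall _ _ _ _ sP _ T L _ h TT L0 e0 ACh.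
rewrite h0 normr0 add0r => H.
have -> : E * (K * E ^+ 2 * T) * `|d| ^+ 2 = E * (K * (E * `|d|) ^+ 2 * T) by
  ring.
apply: H => // j jk.
apply: ae_betweenS (ae_betweenI (cD j jk) (bD j jk)) => // t tj [D1 D2] _.
have tT : 0 <= t <= T by apply: (switch_sub sP jk); lra.
exists (G j (chi t) t - G j (chib t) t - d *m (W t *m A j t)).
  apply: hasDB; first exact: hasDB.
  by rewrite -[d *m _]add0r -(mul0mx _ (W t)); apply: hasD_mul;
    [exact: hasD_cst | exact: WD].
have -> : G j (chi t) t - G j (chib t) t - d *m (W t *m A j t) =
    h t *m A j t +
    (G j (chi t) t - G j (chib t) t - (chi t - chib t) *m A j t).
  have -> : h t *m A j t = (chi t - chib t) *m A j t - d *m (W t *m A j t).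
    by rewrite mulmxBl mulmxA.
  by rewrite [RHS]addrC subrKA.
apply: (le_trans (ler_normD _ _)); apply: lerD.
  apply: (le_trans (mx_norm_mul _ _)).
  by rewrite mulrCA mulrC ler_wpM2r // A_bound //; lra.
apply: (le_trans (G_taylor jk tj _)).
  exact: (solution_stays_in_tube sol small tT).
rewrite ler_wpM2l // ler_pXn2r ?nnegrE //; exact: near0.
Qed.

(** The derivative W A_j y^T - W A_j y^T of W y^T vanishes almost everywhere. *)
Lemma adjoint_pairing W (y : R -> 'rV[R]_N) : abs_continuous 0 T W -> W 0 =
  1%:M ->
  (forall j t, (j <= k)%N -> s j < t < s j.+1 -> hasD W t (W t *m A j t)) ->
  abs_continuous 0 T y ->
  (forall j, (j <= k)%N -> ae_between (s j) (s j.+1) (fun t =>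
     hasD y t (- (y t *m (A j t)^T)))) ->
  W T *m (y T)^T = (y 0)^T.
Proof.
move=> ACW W0 WD ACy yD.
have TT : 0 <= T <= T by rewrite lexx T0.
pose h t := W t *m (y t)^T.
have H : `|h T - h 0| <= 0 - 0.
  apply: (growth_pieces (g := fun=> 0) sP TT) => //.
    by apply: abs_continuous_mul => //; exact: abs_continuous_tr.
  move=> j jk; apply: ae_betweenS (yD j jk) => // t tj Dy _.
  exists 0, 0; split; [|exact: hasD_cst|by rewrite normr0].
  have -> : 0 = W t *m A j t *m (y t)^T + W t *m (- (y t *m (A j t)^T))^T.
    by rewrite linearN /= trmx_mul trmxK mulmxN mulmxA subrr.
  by apply: hasD_mul; [exact: WD | exact: hasD_tr].
apply/eqP; rewrite -subr_eq0 -normr_le0; move: H.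
by rewrite subrr /h W0 mul1mx.
Qed.

End Flow.

(** * Estimates that follow from continuous differentiability on a set *)

Section MatrixContinuity.
Variables (R : realType) (m n1 n2 : nat).

Lemma lsub_continuous (c : R -> 'M[R]_(m, n1 + n2)) : continuous c ->
  continuous (fun t => lsubmx (c t)).
Proof.
move=> cc t; apply: (@continuous_comp _ _ _ c lsubmx); first exact: cc.
by apply: lipschitz1_continuous => x y; rewrite -linearB mx_norm_lsub.
Qed.

Lemma rsub_continuous (c : R -> 'M[R]_(m, n1 + n2)) : continuous c ->
  continuous (fun t => rsubmx (c t)).
Proof.
move=> cc t; apply: (@continuous_comp _ _ _ c rsubmx); first exact: cc.
by apply: lipschitz1_continuous => x y; rewrite -linearB mx_norm_rsub.
Qed.

Lemma row_mx_continuous (c1 : R -> 'M[R]_(m, n1)) (c2 : R -> 'M[R]_(m, n2)) :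
  continuous c1 -> continuous c2 -> continuous (fun t => row_mx (c1 t) (c2 t)).
Proof.
move=> cc1 cc2 t; apply/cvgrPdist_le => e e0.
have e2 : 0 < e / 2 by rewrite divr_gt0.
have /cvgrPdist_le/(_ _ e2) n1' := cc1 t.
have /cvgrPdist_le/(_ _ e2) n2' := cc2 t.
apply: filterS2 n1' n2' => u h1 h2.
rewrite opp_row_mx add_row_mx (le_trans (mx_norm_row _ _)) //.
by rewrite (splitr e) lerD.
Qed.

Lemma vec_mx_continuous (c : R -> 'rV[R]_(m * n1)) : continuous c ->
  continuous (fun t => vec_mx (c t) : 'M[R]_(m, n1)).
Proof.
move=> cc t; apply: (@continuous_comp _ _ _ c vec_mx); first exact: cc.
by apply: lipschitz1_continuous => x y; rewrite -linearB mx_norm_vec.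
Qed.

Lemma opp_continuous (V : normedModType R) (c : R -> V) : continuous c ->
  continuous (fun t => - c t).
Proof. by move=> cc t; apply: cvgN; exact: cc. Qed.

Lemma add_continuous (V : normedModType R) (c1 c2 : R -> V) : continuous c1 ->
  continuous c2 -> continuous (fun t => c1 t + c2 t).
Proof. by move=> cc1 cc2 t; apply: cvgD; [exact: cc1 | exact: cc2]. Qed.

Lemma matrix_rows_continuous (F : R -> 'I_m -> 'rV[R]_n1) :
  (forall i, continuous (F^~ i)) ->
  continuous (fun t => \matrix_i F t i : 'M[R]_(m, n1)).
Proof.
move=> cF t; apply/cvgrPdist_le => e e0.
have H i : \forall u \near t, `|F t i - F u i| <= e.
  by have /cvgrPdist_le := cF i t; apply.
have := @filter_forall _ _ _ _ (nbhs_filter t) H.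
apply: filterS => u hu; apply: mx_norm_le => [|i j]; first exact: ltW.
by apply: le_trans (hu i); apply: le_trans (mx_entry_le _ 0 j); rewrite !mxE.
Qed.

End MatrixContinuity.

Lemma within_continuous_path (R : realType) (X Y : topologicalType)
    (S : set X) (g : X -> Y) (c : R -> X) : {within S, continuous g} ->
  continuous c -> (forall t, S (c t)) -> continuous (fun t => g (c t)).
Proof.
move=> /subspace_continuousP gS cc cS t.
apply: cvg_trans (gS (c t) (cS t)) => B /= gB.
have cB : \forall u \near t, S (c u) -> B (g (c u)) := cc t _ gB.
suff : \forall u \near t, B (g (c u)) by [].
by apply: filterS cB => u; apply; exact: cS.
Qed.

Lemma pair_continuous (R : realType) (X Y : topologicalType) (c1 : R -> X)
    (c2 : R -> Y) : continuous c1 -> continuous c2 ->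
  continuous (fun t => (c1 t, c2 t)).
Proof. by move=> cc1 cc2 t; apply: cvg_pair; [exact: cc1 | exact: cc2]. Qed.

Section C1Facts.
Variables (R : realType) (N q : nat) (S : set ('rV[R]_N * R)).
Variables (g : 'rV[R]_N * R -> 'rV[R]_q).
Variables (Dchi : 'rV[R]_N * R -> 'M[R]_(N, q)) (Dt : 'rV[R]_N * R -> 'rV[R]_q).
Hypothesis gC1 : C1_on S g Dchi Dt.

Lemma C1_on_continuous : {within S, continuous g}.
Proof.
have [gD _ _] := gC1.
apply/subspace_continuousP => z Sz; apply/cvgrPdist_le => e e0.
pose M := N%:R * `|Dchi z| + `|Dt z| + 1.
have M0 : 0 < M by rewrite ltr_wpDl // addr_ge0 // mulr_ge0.
have zM0 : \forall w \near z, `|w - z| <= e / M.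
  apply/nbhs_normP; exists (e / M) => /=; first by rewrite divr_gt0.
  by move=> w; rewrite /= distrC => /ltW.
have zM : \forall w \near within S (nbhs z), `|w - z| <= e / M.
  by rewrite near_withinE; apply: filterS zM0.
apply: filterS2 (gD z Sz 1 ltr01) zM => w; rewrite mul1r => gw wz.
have w1 : `|w.1 - z.1| <= `|w - z| by rewrite [leRHS]prod_normE le_max lexx.
have w2 : `|w.2 - z.2| <= `|w - z| by rewrite [leRHS]prod_normE le_max lexx
  orbT.
rewrite distrC -[g w - g z](subrK ((w.1 - z.1) *m Dchi z + (w.2 - z.2) *: Dt
  z)).
apply: (le_trans (ler_normD _ _)).
have n1 := ler_normD ((w.1 - z.1) *m Dchi z) ((w.2 - z.2) *: Dt z).
have n2 := mx_norm_mul (w.1 - z.1) (Dchi z).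
have n3 : N%:R * (`|w.1 - z.1| * `|Dchi z|) <= N%:R * (`|w - z| * `|Dchi z|).
  by rewrite ler_wpM2l // ler_wpM2r.
have n4 : `|(w.2 - z.2) *: Dt z| <= `|w - z| * `|Dt z|.
  by rewrite normrZ ler_wpM2r.
have n5 : M * `|w - z| <= e by rewrite mulrC -ler_pdivlMr.
rewrite /M in n5; lra.
Qed.

Lemma C1_on_frozen x t e : S (x, t) -> 0 < e -> exists2 r, 0 < r &
  forall y, S (y, t) -> `|y - x| < r ->
    `|g (y, t) - g (x, t) - (y - x) *m Dchi (x, t)| <= e * `|y - x|.
Proof.
move=> Sx e0; have [gD _ _] := gC1.
have /nbhs_normP[r /= r0 rP] := gD _ Sx _ e0.
exists r => // y Sy yx.
have E : `|(y, t) - (x, t) : 'rV[R]_N * R| = `|y - x|.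
  by rewrite prod_normE /= subrr normr0 max_l.
have dist : `|(x, t) - (y, t) : 'rV[R]_N * R| < r by rewrite distrC E.
have := rP (y, t) dist Sy; rewrite E.
by rewrite [(y, t).2 - _]subrr scale0r addr0.
Qed.

(** The mean value bound for r |-> g(x + r v) - r v Dchi(x), v = y - x, whose
    derivative v (Dchi(x + r v) - Dchi(x)) is quadratic in v. *)
Lemma frozen_taylor L t : (forall x y, S (x, t) -> S (y, t) ->
    `|Dchi (x, t) - Dchi (y, t)| <= L * `|x - y|) ->
  (forall x y r, S (x, t) -> S (y, t) -> 0 <= r <= 1 ->
     S (x + r *: (y - x), t)) ->
  forall x y, S (x, t) -> S (y, t) ->
  `|g (y, t) - g (x, t) - (y - x) *m Dchi (x, t)|
    <= N%:R * `|L| * `|y - x| ^+ 2.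
Proof.
move=> DL Sconv x y Sx Sy.
pose v := y - x; pose w r := x + r *: v.
pose h r := g (w r, t) - r *: (v *m Dchi (x, t)).
have -> : g (y, t) - g (x, t) - (y - x) *m Dchi (x, t) = h 1 - h 0.
  by rewrite /h /w !scale0r !scale1r subr0 addr0 /v (addrC x) subrK addrAC.
rewrite -[leRHS]mulr1 -{3}(subr0 1).
apply: (@mean_value_bound _ _ 0 1 _ h
  (fun r => v *m (Dchi (w r, t) - Dchi (x, t)))) => // r r01.
have Sw : S (w r, t) by exact: Sconv.
have wx : w r - x = r *: v by rewrite /w addrAC subrr add0r.
have r0 : 0 <= r by lra.
split.
  apply: (le_trans (mx_norm_mul _ _)); rewrite -mulrA ler_wpM2l //.
  have := DL _ _ Sw Sx; rewrite wx normrZ (ger0_norm r0) => D1.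
  have D2 : L * (r * `|v|) <= `|L| * `|v|.
    rewrite mulrA ler_wpM2r //.
    apply: (@le_trans _ _ (`|L| * r)); first by rewrite ler_wpM2r // ler_norm.
    by rewrite ler_piMr //; lra.
  by rewrite expr2 mulrCA ler_wpM2l // (le_trans D1).
move=> e e0.
have e1 : 0 < e / (`|v| + 1) by rewrite divr_gt0 // ltr_wpDl.
have [d d0 dP] := C1_on_frozen Sw e1.
apply/nbhs_normP; exists (d / (`|v| + 1)) => /=; first by rewrite divr_gt0 //
  ltr_wpDl.
move=> u /=; rewrite distrC => ur u01.
have wu : w u - w r = (u - r) *: v by rewrite /w opprD addrACA subrr add0r
  scalerBl.
have := dP (w u) (Sconv _ _ _ Sx Sy u01); rewrite wu normrZ.
have v1 : 0 < `|v| + 1 by rewrite ltr_wpDl.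
have uv : `|u - r| * `|v| <= `|u - r| * (`|v| + 1) by rewrite ler_wpM2l //
  lerDl.
have ud : `|u - r| * (`|v| + 1) < d by rewrite -ltr_pdivlMr.
move=> /(_ (le_lt_trans uv ud)) H.
have -> : h u - h r - (u - r) *: (v *m (Dchi (w r, t) - Dchi (x, t))) =
    g (w u, t) - g (w r, t) - (u - r) *: v *m Dchi (w r, t).
  rewrite /h mulmxBr scalerBr -scalemxAl.
  have -> : u *: (v *m Dchi (x, t)) =
      r *: (v *m Dchi (x, t)) + (u - r) *: (v *m Dchi (x, t)).
    by rewrite -scalerDl addrC subrK.
  move: (g _) (g _) (_ *: _) (_ *: _) (_ *: _) => a b X Y Z.
  by apply/matrixP => i j; rewrite !mxE; ring.
apply: (le_trans H).
have -> : e / (`|v| + 1) * (`|u - r| * `|v|) =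
    e * `|u - r| * (`|v| / (`|v| + 1)) by ring.
rewrite ler_piMr ?mulr_ge0 ?(ltW e0) //.
by rewrite ler_pdivrMr // mul1r lerDl.
Qed.

End C1Facts.

(** * The field of the coupled system *)

Section Assemble.
Variables (R : realType) (n : nat).
Implicit Types (c x y v : 'rV[R]_(n + n)) (d : 'rV[R]_(n + n * n)).

(** With c = (x, p) and d = (f_j, mxvec f_jx) this is (f_j, - p f_jx).  Its blocks
    are linear in d and bilinear in (c, d), so estimates on the pair
    (f_j, f_jx) transfer to the field. *)
Definition assemble c d : 'rV[R]_(n + n) :=
  row_mx (lsubmx d) (- (rsubmx c *m vec_mx (rsubmx d))).

(** The derivative of [assemble] at (c, d) in the direction (v, dv). *)
Definition assemble_lin c d v (dv : 'rV[R]_(n + n * n)) : 'rV[R]_(n + n) :=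
  row_mx (lsubmx dv)
    (- (rsubmx v *m vec_mx (rsubmx d) + rsubmx c *m vec_mx (rsubmx dv))).

(** The derivative of c |-> assemble c (d c), where D is the derivative of d. *)
Definition assemble_jac c d (D : 'M[R]_(n + n, n + n * n)) : 'M[R]_(n + n) :=
  \matrix_i assemble_lin c d (delta_mx 0 i) (delta_mx 0 i *m D).

Lemma mul_assemble_jac c d D v :
  v *m assemble_jac c d D = assemble_lin c d v (v *m D).
Proof.
have lin : linear (fun v => assemble_lin c d v (v *m D)).
  move=> a u w; rewrite /assemble_lin scale_row_mx add_row_mx.
  congr row_mx; first by rewrite mulmxDl -scalemxAl linearP.
  rewrite mulmxDl -scalemxAl !linearP /= mulmxDl -scalemxAl.
  by rewrite scalerN -opprD scalerDr addrACA.
pose F : {linear 'rV[R]_(n + n) -> 'rV[R]_(n + n)} :=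
  HB.pack (fun v => assemble_lin c d v (v *m D))
    (GRing.isLinear.Build _ _ _ _ _ lin).
rewrite -[RHS]/(F v) {2}(row_sum_delta v) linear_sum mulmx_sum_row.
by apply: eq_bigr => i _; rewrite linearZ rowK.
Qed.

Let V_norm (d : 'rV[R]_(n + n * n)) :
  `|(vec_mx (rsubmx d) : 'M[R]_n)| <= `|d|.
Proof. exact: le_trans (mx_norm_vec _) (mx_norm_rsub _). Qed.

Let mul_norm c d : `|rsubmx c *m (vec_mx (rsubmx d) : 'M[R]_n)| <= n%:R * (`|c|
  * `|d|).
Proof.
apply: (le_trans (mx_norm_mul _ _)); rewrite ler_wpM2l // ler_pM //
  mx_norm_rsub //.
Qed.

Let lsubB p (d d' : 'rV[R]_(n + p)) : lsubmx (d - d') = lsubmx d - lsubmx d'.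
Proof. exact: linearB. Qed.

Let rsubB p (d d' : 'rV[R]_(n + p)) : rsubmx (d - d') = rsubmx d - rsubmx d'.
Proof. exact: linearB. Qed.

Let vecB (d d' : 'rV[R]_(n * n)) : vec_mx (d - d') = vec_mx d - vec_mx d'.
Proof. exact: linearB. Qed.

Lemma assemble_lip x y d d' :
  `|assemble x d - assemble y d'| <=
  `|d - d'| + n%:R * (`|x - y| * `|d| + `|y| * `|d - d'|).
Proof.
have -> : assemble x d - assemble y d' = row_mx (lsubmx (d - d'))
    (- (rsubmx (x - y) *m vec_mx (rsubmx d) +
        rsubmx y *m vec_mx (rsubmx (d - d')))).
  rewrite /assemble opp_row_mx add_row_mx !(lsubB, rsubB, vecB); congr row_mx.
  by rewrite mulmxBl mulmxBr subrKA opprB opprK addrC.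
apply: (le_trans (mx_norm_row _ _)); rewrite lerD ?mx_norm_lsub //.
by rewrite normrN (le_trans (ler_normD _ _)) // mulrDr lerD.
Qed.

Lemma assemble_taylor x c d d' e :
  `|assemble x d - assemble c d' - assemble_lin c d' (x - c) e| <=
  `|d - d' - e| + n%:R * (`|c| * `|d - d' - e| + `|x - c| * `|d - d'|).
Proof.
have -> : assemble x d - assemble c d' - assemble_lin c d' (x - c) e =
   row_mx (lsubmx (d - d' - e))
    (- (rsubmx c *m vec_mx (rsubmx (d - d' - e)) +
        rsubmx (x - c) *m vec_mx (rsubmx (d - d')))).
  rewrite /assemble /assemble_lin !opp_row_mx !add_row_mx !(lsubB, rsubB, vecB).
  congr row_mx; rewrite !(mulmxBl, mulmxBr).
  move: (_ *m _) (_ *m _) (_ *m _) (_ *m _) (_ *m _) => A B C D E.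
  by apply/matrixP => i j; rewrite !mxE; ring.
apply: (le_trans (mx_norm_row _ _)); rewrite lerD ?mx_norm_lsub //.
by rewrite normrN (le_trans (ler_normD _ _)) // mulrDr lerD.
Qed.

Lemma assemble_continuous (c : R -> 'rV[R]_(n + n))
    (d : R -> 'rV[R]_(n + n * n)) : continuous c -> continuous d ->
  continuous (fun t => assemble (c t) (d t)).
Proof.
move=> cc cd; apply: row_mx_continuous; first exact: lsub_continuous.
apply: opp_continuous; apply: mulmx_continuous; first exact: rsub_continuous.
by apply: vec_mx_continuous; exact: rsub_continuous.
Qed.

Lemma assemble_jac_continuous (c : R -> 'rV[R]_(n + n))
    (d : R -> 'rV[R]_(n + n * n)) (D : R -> 'M[R]_(n + n, n + n * n)) :
  continuous c -> continuous d -> continuous D ->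
  continuous (fun t => assemble_jac (c t) (d t) (D t)).
Proof.
move=> cc cd cD; apply: matrix_rows_continuous => i.
have cDi : continuous (fun t => delta_mx 0 i *m D t : 'rV[R]_(n + n * n)).
  by apply: mulmx_continuous => //; exact: cst_continuous.
apply: row_mx_continuous; first exact: lsub_continuous.
apply: opp_continuous; apply: add_continuous; apply: mulmx_continuous.
- exact: cst_continuous.
- by apply: vec_mx_continuous; exact: rsub_continuous.
- exact: rsub_continuous.
- by apply: vec_mx_continuous; exact: rsub_continuous.
Qed.

End Assemble.

Definition coupled_field (R : realType) (n m : nat)
    (f : 'rV[R]_n * 'rV[R]_m -> 'rV[R]_n)
    (phi : nat -> 'rV[R]_n -> 'rV[R]_n -> R -> 'rV[R]_m)
    (j : nat) (chi : 'rV[R]_(n + n)) (t : R) : 'rV[R]_(n + n) :=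
  assemble chi (dynamics_pair f phi j (chi, t)).

Lemma coupled_fieldE (R : realType) (n m : nat)
    (f : 'rV[R]_n * 'rV[R]_m -> 'rV[R]_n)
    (phi : nat -> 'rV[R]_n -> 'rV[R]_n -> R -> 'rV[R]_m) j x p t :
  coupled_field f phi j (row_mx x p) t =
  row_mx (fj f phi j x p t) (- (p *m fjx f phi j x p t)).
Proof.
by rewrite /coupled_field /assemble /dynamics_pair /= !row_mxKl !row_mxKr
  mxvecK.
Qed.

(** The Hamiltonian is the pairing of the field with the adjoint variable. *)
Lemma hamiltonianE (R : realType) (n m : nat)
    (f : 'rV[R]_n * 'rV[R]_m -> 'rV[R]_n)
    (phi : nat -> 'rV[R]_n -> 'rV[R]_n -> R -> 'rV[R]_m) j x p y1 y2 t :
  hamiltonian f phi j x p y1 y2 t =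
  (coupled_field f phi j (row_mx x p) t *m (row_mx y1 y2)^T) 0 0.
Proof.
rewrite coupled_fieldE tr_row_mx mul_row_col mulNmx /hamiltonian [RHS]mxE.
congr (_ + _); last by rewrite [RHS]mxE.
by rewrite -[in RHS](trmxK (fj f phi j x p t)) -trmx_mul [RHS]mxE.
Qed.

Lemma derive_quadratic (R : realType) (V : normedModType R) (F : V -> R) (a v :
  V)
    (l K r : R) : 0 < r ->
  (forall h, `|h| < r -> `|F (h *: v + a) - F a - h * l| <= K * h ^+ 2) ->
  'D_v F a = l.
Proof.
move=> r0 FK; apply: cvg_lim => //; apply/cvgrPdist_le => e e0.
pose K1 := `|K| + 1; have K10 : 0 < K1 by rewrite ltr_wpDl.
exists (Num.min r (e / K1)) => /=; first by rewrite lt_min r0 divr_gt0.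
move=> h; rewrite /ball_ /= sub0r normrN lt_min => /andP[hr he] h0.
have H : `|F (h *: v + a) - F a - h * l| <= e * `|h|.
  apply: (le_trans (FK h hr)).
  have hK : K1 * `|h| <= e by rewrite mulrC -ler_pdivlMr // ltW.
  rewrite -[h ^+ 2]ger0_norm ?sqr_ge0 // normrX expr2 mulrA ler_wpM2r //.
  apply: le_trans hK; rewrite ler_wpM2r // /K1.
  by rewrite (le_trans (ler_norm _)) // lerDl.
rewrite distrC -[X in _ - X](mulKf h0) /GRing.scale /= -mulrBr normrM normfV.
by rewrite ler_pdivrMl ?normr_gt0 // (mulrC `|h|); exact: H.
Qed.

Section RegularField.
Variables (R : realType) (n m k : nat) (T : R) (s : nat -> R).
Variables (f : 'rV[R]_n * 'rV[R]_m -> 'rV[R]_n).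
Variables (phi : nat -> 'rV[R]_n -> 'rV[R]_n -> R -> 'rV[R]_m).
Variables (xb pb : R -> 'rV[R]_n).
Hypothesis sP : switching_points T k s.
Hypotheses (ACx : abs_continuous 0 T xb) (ACp : abs_continuous 0 T pb).

Let chib t := row_mx (xb t) (pb t).
Let tau j := clamp (s j) (s j.+1).
Let G := coupled_field f phi.

(** One bound for all of the finitely many pieces. *)
Lemma piecewise_bounded (V : normedModType R) (F : nat -> R -> V) :
  (forall j, (j <= k)%N -> continuous (fun t => F j (clamp (s j) (s j.+1) t)))
    ->
  exists2 M, 0 <= M & forall j t, (j <= k)%N -> s j <= t <= s j.+1 -> `|F j t|
    <= M.
Proof.
move=> Fc.
have /choice[M MP] : forall j, exists M, (j <= k)%N -> forall t,
    s j <= t <= s j.+1 -> `|F j t| <= M.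
  move=> j; case: (leqP j k) => [jk|_]; last by exists 0.
  have [M MP] := @continuous_segment_bounded _ _ _ _ _ (ltW (switch_lt sP jk))
    (continuous_subspaceT (Fc j jk)).
  by exists M => _ t tj; have := MP t tj; rewrite clamp_id.
exists (\sum_(j < k.+1) `|M j|) => [|j t jk tj]; first exact: sumr_ge0.
have jk1 : (j < k.+1)%N by [].
rewrite (bigD1 (Ordinal jk1)) //= (le_trans (MP j jk t tj)) //.
by rewrite (le_trans (ler_norm _)) // lerDl sumr_ge0.
Qed.

(** The constants come from the bounds on the compact curve chibar of the pair,
    of its derivative and of A, extended to the tube by the Lipschitz bound on
    the derivative. *)
Lemma regular_field : generalized_state_regularity f phi T k s xb pb ->
  exists rho L K : R, exists A : nat -> R -> 'M[R]_(n + n),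
  [/\ [/\ 0 < rho, 0 <= L & 0 <= K],
      forall j (c : R -> 'rV[R]_(n + n)), (j <= k)%N -> continuous c ->
        (forall t, `|c t - chib (tau j t)| <= rho) ->
        continuous (fun t => G j (c t) (tau j t)),
      forall j x y t, (j <= k)%N -> s j <= t <= s j.+1 ->
        `|x - chib t| <= rho -> `|y - chib t| <= rho ->
        `|G j x t - G j y t| <= L * `|x - y|,
      (forall j, (j <= k)%N -> continuous (fun t => A j (tau j t))) /\
      (forall j t, (j <= k)%N -> s j <= t <= s j.+1 ->
        (n + n)%:R * `|A j t| <= L) &
      forall j x t, (j <= k)%N -> s j < t < s j.+1 -> `|x - chib t| <= rho ->
        `|G j x t - G j (chib t) t - (x - chib t) *m A j t|
          <= K * `|x - chib t| ^+ 2].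
Proof.
move=> [rho [L [sm [sp [Dchi [Dt [rho0 smp [sm0 spT] gC1 DL]]]]]]].
pose S j := tube rho (sm j) (sp j.+1) xb pb.
pose g j x t := dynamics_pair f phi j (x, t).
have inS j x t : (j <= k)%N -> s j <= t <= s j.+1 -> `|x - chib t| <= rho ->
    S j (x, t).
  move=> jk tj xr; split => //=; rewrite in_itv /=.
  have [s0 sT _] := sP.
  have smj : sm j <= s j.
    case: j {tj xr} jk => [|j] jk; first by rewrite sm0 s0.
    by have [] := smp j.+1 jk; lra.
  have spj : s j.+1 <= sp j.+1.
    case: (ltngtP j k) => [jk'||->]; [|by rewrite ltnNge jk|by rewrite spT sT].
    by have [] := smp j.+1 jk'; lra.
  by lra.
have bc j : (j <= k)%N -> continuous (fun t => chib (tau j t)).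
  move=> jk; apply: (@abs_continuous_clamp _ _ T).
  - by have := switch_range sP (leqW jk); lra.
  - exact/ltW/(switch_lt sP).
  - by have := @switch_range _ _ _ _ sP j.+1 jk; lra.
  - exact: abs_continuous_row.
have tauI j t : (j <= k)%N -> s j <= tau j t <= s j.+1.
  by move=> jk; apply: clamp_itv; exact/ltW/(switch_lt sP).
have path j (c : R -> 'rV[R]_(n + n)) : (j <= k)%N -> continuous c ->
    continuous (fun t => (c t, tau j t)).
  move=> jk cc; apply: pair_continuous => //.
  by apply: clamp_continuous; exact/ltW/(switch_lt sP).
have gc j (c : R -> 'rV[R]_(n + n)) : (j <= k)%N -> continuous c ->
    (forall t, `|c t - chib (tau j t)| <= rho) ->
    continuous (fun t => g j (c t) (tau j t)).
  move=> jk cc cr.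
  apply: (within_continuous_path (C1_on_continuous (gC1 j jk)) (path _ _ jk
    cc)).
  by move=> t; apply: inS => //; exact: tauI.
have gbc j : (j <= k)%N -> continuous (fun t => g j (chib (tau j t)) (tau j t)).
  by move=> jk; apply: gc => // [|t]; [exact: bc | rewrite subrr normr0 ltW].
have Dbc j : (j <= k)%N -> continuous (fun t => Dchi j (chib (tau j t), tau j
  t)).
  move=> jk; have [_ Dc _] := gC1 j jk.
  apply: (within_continuous_path Dc (path _ _ jk (bc j jk))).
  by move=> t; apply: inS => //; [exact: tauI | rewrite subrr normr0 ltW].
pose A j t := assemble_jac (chib t) (g j (chib t) t) (Dchi j (chib t, t)).
have Ac j : (j <= k)%N -> continuous (fun t => A j (tau j t)).
  by move=> jk; apply: assemble_jac_continuous; [exact: bc|exact: gbc|exact: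
    Dbc].
have [B1 B10 B1P] := @piecewise_bounded _ (fun=> chib) bc.
have [B2 B20 B2P] := @piecewise_bounded _ (fun j t => g j (chib t) t) gbc.
have [B3 B30 B3P] := @piecewise_bounded _ (fun j t => Dchi j (chib t, t)) Dbc.
have [B4 B40 B4P] := @piecewise_bounded _ A Ac.
pose N := (n + n)%N; pose M := N%:R * `|L|; have M0 : 0 <= M by rewrite
  mulr_ge0.
have taylor j x y t : (j <= k)%N -> s j <= t <= s j.+1 ->
    `|x - chib t| <= rho -> `|y - chib t| <= rho ->
    `|g j y t - g j x t - (y - x) *m Dchi j (x, t)| <= M * `|y - x| ^+ 2.
  move=> jk tj xr yr.
  apply: (frozen_taylor (gC1 j jk) (L := L) (t := t)) => //; try exact: inS.
    by move=> u v Su Sv; apply: DL.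
  move=> u v r [/= _ ur] [/= _ vr] r01; apply: inS => //.
  (* the tube is convex at each fixed time *)
  have -> : u + r *: (v - u) - chib t = (1 - r) *: (u - chib t) + r *: (v -
    chib t).
    by apply/matrixP => a b; rewrite !mxE; ring.
  apply: (le_trans (ler_normD _ _)); rewrite !normrZ !ger0_norm; [|lra|lra].
  have : (1 - r) * `|u - chib t| <= (1 - r) * rho by apply: ler_wpM2l => //;
    lra.
  have : r * `|v - chib t| <= r * rho by apply: ler_wpM2l => //; lra.
  by lra.
pose Lg := N%:R * (B3 + `|L| * rho) + M * (rho + rho).
have Lg0 : 0 <= Lg by rewrite !addr_ge0 ?mulr_ge0 ?addr_ge0 ?mulr_ge0 // ltW.
have glip j x y t : (j <= k)%N -> s j <= t <= s j.+1 ->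
    `|x - chib t| <= rho -> `|y - chib t| <= rho ->
    `|g j y t - g j x t| <= Lg * `|y - x|.
  move=> jk tj xr yr.
  have Sx := inS j x t jk tj xr.
  have Sc : S j (chib t, t) by apply: inS => //; rewrite subrr normr0 ltW.
  have Dx : `|Dchi j (x, t)| <= B3 + `|L| * rho.
    rewrite -[Dchi j (x, t)](subrK (Dchi j (chib t, t))).
    rewrite (le_trans (ler_normD _ _)) // addrC lerD ?B3P //.
    apply: (le_trans (DL j jk _ _ _ Sx Sc)).
    apply: (@le_trans _ _ (`|L| * `|x - chib t|)).
      by rewrite ler_wpM2r // ler_norm.
    by rewrite ler_wpM2l.
  have yx : `|y - x| <= rho + rho.
    have := ler_normB (y - chib t) (x - chib t).
    by rewrite opprB subrKA; lra.
  have h1 := taylor j x y t jk tj xr yr.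
  have h2 := mx_norm_mul (y - x) (Dchi j (x, t)).
  have h3 := ler_normD (g j y t - g j x t - (y - x) *m Dchi j (x, t))
    ((y - x) *m Dchi j (x, t)).
  rewrite subrK in h3.
  have h4 : (n + n)%:R * (`|y - x| * `|Dchi j (x, t)|) <=
      N%:R * (B3 + `|L| * rho) * `|y - x|.
    by rewrite -mulrA ler_wpM2l // mulrC ler_wpM2r.
  have h5 : M * `|y - x| ^+ 2 <= M * (rho + rho) * `|y - x|.
    by rewrite expr2 mulrA ler_wpM2r // ler_wpM2l.
  by rewrite /Lg mulrDl; lra.
pose B5 := B2 + Lg * rho.
have B50 : 0 <= B5 by rewrite addr_ge0 // mulr_ge0 // ltW.
have gB j x t : (j <= k)%N -> s j <= t <= s j.+1 -> `|x - chib t| <= rho ->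
    `|g j x t| <= B5.
  move=> jk tj xr; rewrite -[g j x t](subrK (g j (chib t) t)).
  rewrite (le_trans (ler_normD _ _)) // /B5 addrC lerD ?B2P //.
  apply: (@le_trans _ _ (Lg * `|x - chib t|)); last by rewrite ler_wpM2l.
  by apply: glip => //; rewrite subrr normr0 ltW.
pose LG := Lg + n%:R * (B5 + (B1 + rho) * Lg).
have LG0 : 0 <= LG.
  by rewrite addr_ge0 // mulr_ge0 // addr_ge0 // mulr_ge0 // addr_ge0 // ltW.
exists rho, (LG + N%:R * B4), (M + n%:R * (B1 * M + Lg)), A.
split.
- split => //; first by rewrite addr_ge0 // mulr_ge0.
  by rewrite addr_ge0 // mulr_ge0 // addr_ge0 // mulr_ge0.
- move=> j c jk cc cr; apply: assemble_continuous => //; exact: gc.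
- move=> j x y t jk tj xr yr.
  apply: (@le_trans _ _ (LG * `|x - y|)); last by rewrite ler_wpM2r // lerDl
    mulr_ge0.
  apply: (le_trans (assemble_lip _ _ _ _)).
  rewrite -!/(g j _ t).
  have h1 := glip j y x t jk tj yr xr.
  have h2 := gB j x t jk tj xr.
  have h3 : `|y| <= B1 + rho.
    by rewrite -[y](subrK (chib t)) (le_trans (ler_normD _ _)) // addrC lerD //
      (B1P j).
  have h4 : `|x - y| * `|g j x t| <= `|x - y| * B5 by rewrite ler_wpM2l.
  have h5 : `|y| * `|g j x t - g j y t| <= (B1 + rho) * (Lg * `|x - y|).
    by rewrite ler_pM.
  have h6 := ler_wpM2l (ler0n R n) (lerD h4 h5).
  by rewrite /LG; lra.
- split => // j t jk tj.
  by rewrite (le_trans (ler_wpM2l _ (B4P j t jk tj))) // lerDr.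
- move=> j x t jk tj xr; rewrite mul_assemble_jac.
  apply: (le_trans (assemble_taylor _ _ _ _ _)).
  rewrite -!/(g j _ t).
  have tj' : s j <= t <= s j.+1 by lra.
  have cr : `|chib t - chib t| <= rho by rewrite subrr normr0 ltW.
  have h1 := taylor j (chib t) x t jk tj' cr xr.
  have h2 := glip j (chib t) x t jk tj' cr xr.
  have h3 := B1P j t jk tj'.
  have h4 := ler_pM (normr_ge0 _) (normr_ge0 _) h3 h1.
  have h5 := ler_wpM2l (normr_ge0 (x - chib t)) h2.
  have h6 := ler_wpM2l (ler0n R n) (lerD h4 h5).
  rewrite expr2 in h1 h6 *; lra.
Qed.

End RegularField.

(** * Derivatives from quadratic estimates *)

Lemma mulmxr_continuous (R : realType) (p q : nat) (D : 'M[R]_(p, q)) :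
  continuous (mulmxr D : 'rV[R]_p -> 'rV[R]_q).
Proof.
apply: (@lipschitz_continuous _ _ _ _ (p%:R * `|D|)) => x y.
rewrite /= -mulmxBl (le_trans (mx_norm_mul _ _)) //.
by rewrite -mulrA (mulrC `|D|).
Qed.

Lemma quadratic_differentiable (R : realType) (p q : nat)
    (F : 'rV[R]_p -> 'rV[R]_q) (a : 'rV[R]_p) (D : 'M[R]_(p, q)) (C r : R) :
  0 < r ->
  (forall x, `|x - a| < r -> `|F x - F a - (x - a) *m D| <= C * `|x - a| ^+ 2)
    ->
  differentiable F a /\ 'J F a = D.
Proof.
move=> r0 FC.
pose df : {linear 'rV[R]_p -> 'rV[R]_q} := mulmxr D.
have Fo (e : R) : 0 < e ->
    \forall h \near (0 : 'rV[R]_p), `|F (h + a) - (F a + h *m D)| <= e * `|h|.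
  move=> e0.
  pose C1 := `|C| + 1; have C10 : 0 < C1 by rewrite ltr_wpDl.
  apply/nbhs_normP; exists (Num.min r (e / C1)) => /=.
    by rewrite lt_min r0 divr_gt0.
  move=> h; rewrite /= sub0r normrN lt_min => /andP[hr he].
  have := FC (h + a); rewrite addrK => /(_ hr) H.
  rewrite opprD addrA.
  apply: (le_trans H).
  have hC : `|h| * C1 <= e by rewrite -ler_pdivlMr // ltW.
  rewrite expr2 mulrA ler_wpM2r // mulrC.
  apply: le_trans hC; rewrite ler_wpM2l // /C1.
  by rewrite (le_trans (ler_norm _)) // lerDl.
have dF : 'd F a = df :> ('rV[R]_p -> 'rV[R]_q).
  apply: diff_unique; first exact: mulmxr_continuous.
  by apply/eqaddoP => e e0; exact: Fo.
have Fdiff : differentiable F a.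
  apply/diff_locallyP; rewrite dF; split; first exact: mulmxr_continuous.
  by apply/eqaddoP => e e0; exact: Fo.
split => //; apply/row_matrixP => i.
by rewrite !rowE -deriveEjacobian // deriveE // dF.
Qed.

Lemma gradient_comp (R : realType) (p q : nat) (C : 'rV[R]_q -> R)
    (F : 'rV[R]_p -> 'rV[R]_q) (a : 'rV[R]_p) :
  differentiable F a -> differentiable C (F a) ->
  gradient (fun x => C (F x)) a = gradient C (F a) *m jac F a.
Proof.
move=> dF dC; apply/rowP => i; rewrite !mxE.
have dCF : differentiable (C \o F) a by exact: differentiable_comp.
have dFE : 'd F a (delta_mx 0 i) = delta_mx 0 i *m 'J F a.
  by rewrite -deriveE // deriveEjacobian.
rewrite [LHS](deriveE _ dCF) diff_comp //= dFE -rowE.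
rewrite {1}(row_sum_delta (row i _)) linear_sum.
by apply: eq_bigr => l _; rewrite linearZ /= !mxE [RHS]mulrC deriveE.
Qed.

(** * The Hamiltonian and the adjoint system *)

(** Pairing the Taylor estimate of the field with y shows that the Hamiltonian
    has derivative (v A) . y = (y A^T) . v in the direction v; the two gradients
    are read off along the coordinate directions. *)
Lemma hamiltonian_gradient (R : realType) (n m : nat)
    (f : 'rV[R]_n * 'rV[R]_m -> 'rV[R]_n)
    (phi : nat -> 'rV[R]_n -> 'rV[R]_n -> R -> 'rV[R]_m) j t
    (x p y1 y2 : 'rV[R]_n) (rho K : R) (A : 'M[R]_(n + n)) : 0 < rho ->
  (forall c, `|c - row_mx x p| <= rho ->
    `|coupled_field f phi j c t - coupled_field f phi j (row_mx x p) t - (c -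
      row_mx x p) *m A|
      <= K * `|c - row_mx x p| ^+ 2) ->
  row_mx (gradient (fun z => hamiltonian f phi j z p y1 y2 t) x)
         (gradient (fun q => hamiltonian f phi j x q y1 y2 t) p)
  = row_mx y1 y2 *m A^T.
Proof.
move=> rho0 taylor; set y := row_mx y1 y2; set c := row_mx x p in taylor.
have subE (P Q : 'M[R]_1) : (P - Q) 0 0 = P 0 0 - Q 0 0 by rewrite !mxE.
have scaleE a (P : 'M[R]_1) : (a *: P) 0 0 = a * P 0 0 by rewrite mxE.
have trE (P : 'M[R]_1) : P^T 0 0 = P 0 0 by rewrite mxE.
pose F (w : 'rV[R]_(n + n)) := (coupled_field f phi j w t *m y^T) 0 0.
have key (v : 'rV[R]_(n + n)) : exists K1, exists2 r : R, 0 < r & forall h,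
  `|h| < r ->
    `|F (h *: v + c) - F c - h * (y *m A^T *m v^T) 0 0| <= K1 * h ^+ 2.
  exists ((n + n)%:R * (K * `|v| ^+ 2 * `|y|)), (rho / (`|v| + 1)) => [|h hr].
    by rewrite divr_gt0 // ltr_wpDl.
  have hv : `|h *: v + c - c| <= rho.
    rewrite addrK normrZ; move: hr; rewrite ltr_pdivlMr ?ltr_wpDl // => hr.
    by rewrite (le_trans _ (ltW hr)) // ler_wpM2l // lerDl.
  have := taylor _ hv; rewrite addrK => H.
  set e := _ - _ in H.
  have -> : F (h *: v + c) - F c - h * (y *m A^T *m v^T) 0 0 = (e *m y^T) 0 0.
    rewrite /F /e !mulmxBl !subE -!scalemxAl scaleE; congr (_ - _ * _).
    by rewrite -trE !trmx_mul trmxK mulmxA.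
  apply: (le_trans (mx_entry_le _ _ _)); apply: (le_trans (mx_norm_mul _ _)).
  rewrite mx_norm_tr -[leRHS]mulrA ler_wpM2l //.
  rewrite normrZ exprMn in H.
  have -> : K * `|v| ^+ 2 * `|y| * h ^+ 2 = K * (`|h| ^+ 2 * `|v| ^+ 2) * `|y|.
    by rewrite real_normK ?num_real //; ring.
  by rewrite ler_wpM2r.
have FE z q : F (row_mx z q) = hamiltonian f phi j z q y1 y2 t.
  by rewrite hamiltonianE.
have Fc : F c = hamiltonian f phi j x p y1 y2 t := FE x p.
clearbody F; rewrite -[y *m A^T]hsubmxK; congr row_mx; apply/rowP => i; rewrite
  mxE.
- have [K1 [r r0 H]] := key (row_mx (delta_mx 0 i) 0).
  apply: (derive_quadratic (K := K1) r0) => h hr; have := H h hr.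
  have -> : h *: row_mx (delta_mx 0 i) 0 + c = row_mx (h *: delta_mx 0 i + x) p.
    by rewrite scale_row_mx scaler0 add_row_mx add0r.
  have -> : (y *m A^T *m (row_mx (delta_mx 0 i : 'rV[R]_n) 0)^T) 0 0 = lsubmx
    (y *m A^T) 0 i.
    rewrite -{1}[y *m A^T]hsubmxK.
    rewrite tr_row_mx mul_row_col trmx0 mulmx0 addr0.
    by rewrite trmx_delta -colE mxE.
  by rewrite FE Fc.
- have [K1 [r r0 H]] := key (row_mx 0 (delta_mx 0 i)).
  apply: (derive_quadratic (K := K1) r0) => h hr; have := H h hr.
  have -> : h *: row_mx 0 (delta_mx 0 i) + c = row_mx x (h *: delta_mx 0 i + p).
    by rewrite scale_row_mx scaler0 add_row_mx add0r.
  have -> : (y *m A^T *m (row_mx 0 (delta_mx 0 i : 'rV[R]_n))^T) 0 0 = rsubmx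
    (y *m A^T) 0 i.
    rewrite -{1}[y *m A^T]hsubmxK tr_row_mx mul_row_col trmx0 mulmx0 add0r.
    by rewrite trmx_delta -colE mxE.
  by rewrite FE Fc.
Qed.

Lemma coupled_to_piecewise (R : realType) (n m : nat)
    (f : 'rV[R]_n * 'rV[R]_m -> 'rV[R]_n)
    (phi : nat -> 'rV[R]_n -> 'rV[R]_n -> R -> 'rV[R]_m)
    (T : R) (k : nat) (s : nat -> R) (x0 p0 : 'rV[R]_n) (x p : R -> 'rV[R]_n) :
  coupled_solution f phi T k s x0 p0 x p ->
  piecewise_solution T k s (coupled_field f phi) (fun t => row_mx (x t) (p t)).
Proof.
move=> [ACx ACp _ _ D]; split; first exact: abs_continuous_row.
move=> j jk; apply: ae_betweenS (D j jk) => // t _ [Dx Dp].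
by rewrite coupled_fieldE; apply: hasD_row; apply/hasD_is_derive.
Qed.

Lemma piecewise_to_coupled (R : realType) (n m : nat)
    (f : 'rV[R]_n * 'rV[R]_m -> 'rV[R]_n)
    (phi : nat -> 'rV[R]_n -> 'rV[R]_n -> R -> 'rV[R]_m)
    (T : R) (k : nat) (s : nat -> R) (x0 p0 : 'rV[R]_n) (chi : R -> 'rV[R]_(n +
      n)) :
  piecewise_solution T k s (coupled_field f phi) chi -> chi 0 = row_mx x0 p0 ->
  coupled_solution f phi T k s x0 p0 (fun t => lsubmx (chi t))
    (fun t => rsubmx (chi t)).
Proof.
move=> [ACc D] c0; split.
- exact: abs_continuous_lsub.
- exact: abs_continuous_rsub.
- by rewrite c0 row_mxKl.
- by rewrite c0 row_mxKr.
move=> j jk; apply: ae_betweenS (D j jk) => // t _ Dt.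
rewrite -[X in coupled_field _ _ _ X _](hsubmxK (chi t)) coupled_fieldE in Dt.
split; apply/hasD_is_derive.
  by have := hasD_lsub Dt; rewrite row_mxKl.
by have := hasD_rsub Dt; rewrite row_mxKr.
Qed.

Theorem mainTheorem4 (R : realType) (n m k : nat) (T : R) (x0 : 'rV[R]_n)
    (f : 'rV[R]_n * 'rV[R]_m -> 'rV[R]_n) (C : 'rV[R]_n -> R)
    (phi : nat -> 'rV[R]_n -> 'rV[R]_n -> R -> 'rV[R]_m)
    (s : nat -> R) (pbar0 : 'rV[R]_n)
    (xbar pbar y1 y2 : R -> 'rV[R]_n)
    (T_gt0 : 0 < T)
    (f_diff : forall z, differentiable f z)
    (C_diff : forall x, differentiable C x)
    (s_switch : switching_points T k s)
    (bar_sol : coupled_solution f phi T k s x0 pbar0 xbar pbar)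
    (bar_reg : generalized_state_regularity f phi T k s xbar pbar)
    (y_sol : adjoint_solution f phi C T k s xbar pbar y1 y2) :
  let xT := terminal_state f phi T k s x0 in
  [/\ \forall p0 \near pbar0,
        exists x p, coupled_solution f phi T k s x0 p0 x p /\
          forall x' p', coupled_solution f phi T k s x0 p0 x' p' ->
            {in `[0, T], x' =1 x} /\ {in `[0, T], p' =1 p},
      differentiable xT pbar0,
      differentiable (fun p0 => C (xT p0)) pbar0,
      gradient (fun p0 => C (xT p0)) pbar0
        = gradient C (xbar T) *m jac xT pbar0 &
      gradient C (xbar T) *m jac xT pbar0 = y2 0].
Proof.
move=> xT.
have [s0 sT _] := s_switch.
have T0 : 0 <= T by exact: ltW.
have [ACx ACp xb0 pb0 _] := bar_sol.
pose chib t := row_mx (xbar t) (pbar t).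
have bsol : piecewise_solution T k s (coupled_field f phi) chib.
  exact: coupled_to_piecewise bar_sol.
have [rho [L [K [A [[rho0 L0 K0] Gc Glip [Ac Ab] taylor]]]]] :=
  regular_field s_switch ACx ACp bar_reg.
have [W [ACW W0 WD]] := variational_matrix s_switch L0 Ac Ab.
pose E := 2 * expR (2 * L * T).
have E0 : 0 < E by rewrite mulr_gt0 // expR_gt0.
pose r := rho / E; have r0 : 0 < r by rewrite divr_gt0.
have dist p0 : `|row_mx x0 p0 - chib 0| <= `|p0 - pbar0|.
  rewrite /chib xb0 pb0 opp_row_mx add_row_mx subrr.
  by rewrite (le_trans (mx_norm_row _ _)) // normr0 add0r.
have small p0 : `|p0 - pbar0| < r -> E * `|row_mx x0 p0 - chib 0| < rho.
  rewrite /r ltr_pdivlMr // mulrC; apply: le_lt_trans.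
  by rewrite ler_wpM2l // ltW.
have uniq p0 x p x' p' : `|p0 - pbar0| < r ->
    coupled_solution f phi T k s x0 p0 x p ->
    coupled_solution f phi T k s x0 p0 x' p' ->
    forall t, 0 <= t <= T -> x' t = x t /\ p' t = p t.
  move=> /small sm sol sol' t tT; apply: eq_row_mx.
  have [_ _ x00 p00 _] := sol; have [_ _ x00' p00' _] := sol'.
  apply/eqP; rewrite -subr_eq0 -normr_le0.
  have := flow_estimate s_switch rho0 L0 bsol Glip
    (coupled_to_piecewise sol') (coupled_to_piecewise sol).
  rewrite /= x00 p00 x00' p00' subrr normr0 mulr0 => H.
  by apply: H.
have exist p0 : `|p0 - pbar0| < r -> exists2 chi : R -> 'rV[R]_(n + n),
    piecewise_solution T k s (coupled_field f phi) chi & chi 0 = row_mx x0 p0.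
  by move=> /small sm; apply: (flow_exists s_switch rho0 L0 bsol Gc Glip).
have xTE p0 x p : `|p0 - pbar0| < r ->
    coupled_solution f phi T k s x0 p0 x p -> xT p0 = x T.
  move=> p0r sol.
  have [x' [p' [sol' ->]]] : [set z | exists x p,
      coupled_solution f phi T k s x0 p0 x p /\ z = x T] (xT p0).
    by apply: getPex; exists (x T), x, p.
  by have [] := uniq _ _ _ _ _ p0r sol sol' T; rewrite ?T0 ?lexx.
have xTb : xT pbar0 = xbar T by apply: (xTE _ _ _ _ bar_sol); rewrite subrr
  normr0.
(* the rows of W(T) that belong to p, restricted to the columns of x *)
pose D := lsubmx (dsubmx (W T)) : 'M[R]_n.
have [xTdiff xTJ] : differentiable xT pbar0 /\ 'J xT pbar0 = D.
  apply: (quadratic_differentiable (C := E * (K * E ^+ 2 * T)) r0) => p0 p0r.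
  have [chi sol c0] := exist p0 p0r.
  rewrite (xTE _ _ _ p0r (piecewise_to_coupled sol c0)) xTb.
  have := flow_derivative s_switch rho0 L0 bsol Glip K0 Ab taylor ACW W0 WD sol.
  rewrite c0 => /(_ (small _ p0r)) H.
  have -> : lsubmx (chi T) - xbar T - (p0 - pbar0) *m D =
      lsubmx (chi T - chib T - (row_mx x0 p0 - chib 0) *m W T).
    rewrite !linearB /= row_mxKl; congr (_ - _).
    rewrite /chib xb0 pb0 opp_row_mx add_row_mx subrr.
    rewrite -[in RHS](vsubmxK (W T)) mul_row_col mul0mx add0r.
    by rewrite -[in RHS](hsubmxK (dsubmx (W T))) mul_mx_row row_mxKl.
  apply: (le_trans (mx_norm_lsub _)); apply: (le_trans H).
  apply: ler_wpM2l; last by rewrite ler_pXn2r ?nnegrE.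
  by rewrite mulr_ge0 ?mulr_ge0 ?exprn_ge0 // ltW.
have CxTdiff : differentiable (fun p0 => C (xT p0)) pbar0.
  exact: differentiable_comp.
split => //.
- apply/nbhs_normP; exists r => // p0 /=; rewrite distrC => p0r.
  have [chi sol c0] := exist p0 p0r; have csol := piecewise_to_coupled sol c0.
  exists (fun t => lsubmx (chi t)), (fun t => rsubmx (chi t)); split => //.
  move=> x' p' sol'; have H := uniq _ _ _ _ _ p0r csol sol'.
  by split => t; rewrite in_itv /= => /H[].
- by rewrite gradient_comp // xTb.
have [ACy1 ACy2 y1T y2T yD] := y_sol.
pose y t := row_mx (y1 t) (y2 t).
have := adjoint_pairing (y := y) s_switch ACW W0 WD (abs_continuous_row ACy1
  ACy2).
rewrite /y y1T y2T => H.
rewrite /jac xTJ; apply: (can_inj trmxK); rewrite trmx_mul trmxK.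
have {}H := H _; rewrite -{1}(vsubmxK (W T)) in H.
have /(congr1 dsubmx) : col_mx (usubmx (W T)) (dsubmx (W T)) *m
    (row_mx (gradient C (xbar T)) 0)^T = (row_mx (y1 0) (y2 0))^T.
  apply: H => j jk; apply: ae_betweenS (yD j jk) => // t tj [D1 D2].
  have <- := hamiltonian_gradient (y1 t) (y2 t) rho0
    (fun c => taylor j c t jk tj).
  by rewrite opp_row_mx; apply: hasD_row; apply/hasD_is_derive.
rewrite mul_col_mx col_mxKd !tr_row_mx col_mxKd.
by rewrite -{1}(hsubmxK (dsubmx (W T))) mul_row_col trmx0 mulmx0 addr0.
Qed.
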